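(* Assume that $\varphi$, the density of the $\theta_j$'s, belongs to the class $H_M(\beta,L)$ for some positive $L$ and $M$ and with $\beta>1$. Assume moreover that the estimators $\widehat\theta_1,\dots,\widehat\theta_{J_n}$ approximate $\theta_1,\dots,\theta_{J_n}$ in the sense defined in the context, that the bias control $$\mathbf E\left((\widehat\theta_j-\theta_j)\,\middle|\,\theta_j\right)=O\left(\frac{\log n}{n}\right)$$ holds uniformly in $j\in\{1,\dots,J_n\}$ and $\theta_j\in\Theta$ as $n\to\infty$, and that the kernel $K$ is smooth, compactly supported and of order $\lfloor\beta\rfloor$. Then, for a suitable choice of the bandwidth $h_n>0$ (depending on $n$, $J_n$ and $\beta$ only), the kernel estimator $$\hat\varphi(x)=\frac1{J_nh_n}\sum_{j=1}^{J_n}K\left(\frac{x-\widehat\theta_j}{h_n}\right),\qquad x\in\Theta,$$ achieves the following rates of convergence as $n$ and $J_n$ tend to $+\infty$: $$\sup_{x\in\Theta}\ \sup_{\varphi\in H_M(\beta,L)}\mathbf E\left([\hat\varphi(x)-\varphi(x)]^2\right)=\begin{cases}O\left(J_n^{-\frac{2\beta}{2\beta+1}}\right),&\text{if }J_n\le(n/\log n)^{\frac{2\beta+1}{\beta+2}},\\[4pt]O\left((n/\log n)^{-\frac{2\beta}{\beta+2}}\right),&\text{if }J_n\ge(n/\log n)^{\frac{2\beta+1}{\beta+2}}.\end{cases}$$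
   Context: Model: $\theta_1,\dots,\theta_{J_n}$ are i.i.d. random variables with density $\varphi$ with respect to Lebesgue measure, supported in $\Theta=[-\tau_0,\tau_0]$, $0<\tau_0<1/4$. For each $n$, with $J_n$ curves ($J_n\ge1$ an integer depending on $n$), one observes $$Y_{ij}=f^{[j]}(t_i-\theta_j)+\sigma\varepsilon_{ij},\qquad t_i=i/n,\ i=1,\dots,n,\ j=1,\dots,J_n,$$ where $f^{[j]}$ are unknown functions, $\sigma>0$ is known, and the $\varepsilon_{ij}$ are i.i.d. standard normal, independent of the $\theta_j$'s. It is assumed that, for $n$ large enough, either always $J_n\le(n/\log n)^{(2\beta+1)/(\beta+2)}$ or always the converse inequality holds. Approximation property: the random variables $\widehat\theta_j$, $1\le j\le J_n$, approximate $\theta_1,\dots,\theta_{J_n}$ if each $\widehat\theta_j$ is measurable with respect to the observations $Y_{1j},\dots,Y_{nj}$ of the $j$-th curve (so the $\widehat\theta_j$ are independent) and the following deviation bound holds: there exist positive constants $c_1,c_2$ such that for any $K_0>0$, for $n$ large enough, uniformly in $j\in\{1,\dots,J_n\}$ and in $\theta_j\in\Theta$ (and over the class of functions to which the $f^{[j]}$ belong), with $x_n=K_0\sqrt{\log n}$, $$\mathbf P\left(\sqrt n\,|\widehat\theta_j-\theta_j|>x_n\,\middle|\,\theta_j\right)\le c_1\exp(-c_2x_n^2).$$ Both this bound and the bias control in the claim concern the conditional law of $\widehat\theta_j$ given $\theta_j$ (i.e. with the shift fixed at a value of $\Theta$), which does not depend on $\varphi$. $\lfloor\beta\rfloor$ is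 the greatest integer strictly less than $\beta$. The Hölder class $H(\beta,L)$ is the set of functions $\varphi:\mathbb R\to\mathbb R$ that are $\ell=\lfloor\beta\rfloor$ times differentiable with $|\varphi^{(\ell)}(x)-\varphi^{(\ell)}(x')|\le L|x-x'|^{\beta-\ell}$ for all $x,x'\in\mathbb{R}$. $H_M(\beta,L)$ is the set of all probability densities with support included in $[-\tau_0,\tau_0]=\Theta$ which belong to $H(\beta,L)$ and are uniformly bounded by $M$. A kernel of order $\ell$ is an integrable function $K:\mathbb R\to\mathbb R$ with $\int K=1$ and $\int u^pK(u)\,du=0$ for $p=1,\dots,\ell$. Smooth means infinitely differentiable.
   Formalization: The formal theorem additionally assumes that E((θ̂_j−θ_j)²|θ_j) is bounded uniformly in j, θ_j∈Θ and n large (true for Θ-valued estimators); without it the claim fails, as the deviation bound does not control moments. *)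

(* Defs.v *)
From HB Require Import structures.
From mathcomp Require Import all_boot all_order all_algebra.
From mathcomp Require Import all_classical all_reals all_analysis.

Set Implicit Arguments.
Unset Strict Implicit.
Unset Printing Implicit Defensive.

Import Order.TTheory GRing.Theory Num.Theory.
Import numFieldNormedType.Exports.

Local Open Scope classical_set_scope.
Local Open Scope ring_scope.

(* Greatest integer *strictly* less than b, for b > 0. *)
Definition sfloor (R : realType) (b : R) : nat := `|Num.ceil b|%N.-1.

Lemma sfloor_itv (R : realType) (b : R) :
  0 < b -> (sfloor b)%:R < b <= (sfloor b).+1%:R.
Proof.
move=> b0; have c0 : 0 < Num.ceil b by rewrite ceil_gt0.
have cn : (0 < `|Num.ceil b|)%N by rewrite absz_gt0 gt_eqF.
have e : (`|Num.ceil b|%N%:R : R) = (Num.ceil b)%:~R.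
  by rewrite -{2}(gtz0_abs c0) -pmulrn.
rewrite /sfloor prednK // e ceil_ge andbT.
have -> : (`|Num.ceil b|%N.-1%:R : R) = (Num.ceil b)%:~R - 1.
  by rewrite -e -{2}(prednK cn) -natr1 addrK.
by have := ceilB1_lt b; rewrite intrB.
Qed.

Section densities_and_kernels.
Variable R : realType.
Implicit Types (phi K : R -> R) (b L M : R).

Definition Theta (tau0 : R) : set R := [set x | - tau0 <= x <= tau0].

Definition holder b L : set (R -> R) := [set phi : R -> R |
  (forall k x, (k < sfloor b)%N -> derivable (derive1n k phi) x 1) /\
  forall x y, `|derive1n (sfloor b) phi x - derive1n (sfloor b) phi y|
              <= L * `|x - y| `^ (b - (sfloor b)%:R)].

Definition holder_density (tau0 : R) M b L : set (R -> R) := [set phi : R -> R |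
  [/\ forall x, 0 <= phi x,
      (\int[lebesgue_measure]_x (phi x)%:E = 1)%E,
      [set x | phi x != 0] `<=` Theta tau0,
      holder b L phi
    & forall x, phi x <= M]].

Definition kernel_of_order K (l : nat) :=
  [/\ lebesgue_measure.-integrable [set: R] (EFin \o K),
      (\int[lebesgue_measure]_u (K u)%:E = 1)%E
    & forall p : nat, (1 <= p <= l)%N ->
        (\int[lebesgue_measure]_u (u ^+ p * K u)%:E = 0)%E].

Definition smooth K := forall (k : nat) (x : R), derivable (derive1n k K) x 1.

Definition compactly_supported K := compact (closure [set u | K u != 0]).

End densities_and_kernels.

Section probability_notions.
Context {R : realType} {d : measure_display} {Omega : measurableType d}.
Variable P : probability Omega R.

Definition has_density (X : {mfun Omega >-> R}) (phi : R -> R) :=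
  forall A : set R, measurable A ->
    P (X @^-1` A) = (\int[lebesgue_measure]_(x in A) (phi x)%:E)%E.

Definition standard_normal (X : {mfun Omega >-> R}) :=
  forall A : set R, measurable A -> P (X @^-1` A) = normal_prob 0 1 A.

Definition mutually_independent (I : finType) (X : I -> {mfun Omega >-> R}) :=
  forall (S : {set I}) (B : I -> set R), (forall i, measurable (B i)) ->
    P [set w | forall i, i \in S -> B i (X i w)]
    = (\prod_(i in S) P (X i @^-1` B i))%E.

Definition gaussian_noise (n : nat) (e : 'I_n -> {mfun Omega >-> R}) :=
  (forall i, standard_normal (e i)) /\ mutually_independent e.

(* The shifts and the errors of m curves observed at n points, listed as one
   family: the theta_j's are i.i.d., the eps_ij's are i.i.d. and the two
   families are independent of each other iff this one is independent. *)
Definition shifts_and_errors (n m : nat) (theta : nat -> {mfun Omega >-> R})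
    (eps : nat -> nat -> {mfun Omega >-> R})
    (k : ('I_m + 'I_n * 'I_m)%type) : {mfun Omega >-> R} :=
  match k with inl j => theta j | inr ij => eps ij.1 ij.2 end.

Definition shift_model (phi : R -> R) (n m : nat)
    (theta : nat -> {mfun Omega >-> R})
    (eps : nat -> nat -> {mfun Omega >-> R}) :=
  [/\ forall j, (j < m)%N -> has_density (theta j) phi,
      forall i j, (i < n)%N -> (j < m)%N -> standard_normal (eps i j)
    & mutually_independent (@shifts_and_errors n m theta eps)].

End probability_notions.

Section estimators.
Variable R : realType.

(* Y_i = g (t_i - s) + sigma e_i, with t_i = i / n for i = 1, ..., n. *)
Definition curve (sigma : R) (g : R -> R) (s : R) (n : nat) (e : 'I_n -> R) :
    n.-tuple R :=
  [tuple g (i.+1%:R / n%:R - s) + sigma * e i | i < n].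

(* An estimator of the j-th shift, being a function of Y_1j, ..., Y_nj, is
   encoded by a Borel function That n j of n real variables. Curves are
   numbered from 0.

   Conditioning on theta_j = s amounts to fixing the shift at s and keeping the
   errors random. The resulting law depends only on That n j, on the signal g
   and on s, so that the conditions below may quantify over all realizations e
   of the errors on a probability space (W, Q). *)
Definition shift_estimators := forall n : nat, nat -> n.-tuple R -> R.

Variables (sigma tau0 : R) (J : nat -> nat) (That : shift_estimators).

Definition approximates_shifts (F : set (R -> R)) :=
  (forall n j, measurable_fun [set: n.-tuple R] (@That n j)) /\
  exists c1 c2 : R, [/\ 0 < c1, 0 < c2 &
    forall K0 : R, 0 < K0 -> \forall n \near \oo,
    forall (j : nat) (g : R -> R) (s : R),
      (j < J n)%N -> F g -> Theta tau0 s ->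
    forall (d : measure_display) (W : measurableType d) (Q : probability W R)
        (e : 'I_n -> {mfun W >-> R}), gaussian_noise Q e ->
    let x_n := K0 * Num.sqrt (ln n%:R) in
    (Q [set w | x_n <
          Num.sqrt n%:R * `|@That n j (curve sigma g s (fun i => e i w)) - s|]%R
     <= (c1 * expR (- (c2 * x_n ^+ 2)))%:E)%E].

Definition bias_control (f : nat -> R -> R) :=
  exists C : R, \forall n \near \oo,
    forall (j : nat) (s : R), (j < J n)%N -> Theta tau0 s ->
    forall (d : measure_display) (W : measurableType d) (Q : probability W R)
        (e : 'I_n -> {mfun W >-> R}), gaussian_noise Q e ->
    (`| 'E_Q[fun w => (@That n j (curve sigma (f j) s (fun i => e i w)) - s)%R]|
     <= (C * (ln n%:R / n%:R))%:E)%E.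

(* For a given K0 the deviation bound is only known beyond some n(K0), so it
   does not control moments: an event of probability exp(-n) on which the
   estimator is huge may compensate, in bias_control, a shift of the
   estimator by n^(-1/2), and this shift would spoil the rates. Estimators
   with values in Theta satisfy the following condition. *)
Definition bounded_mse (f : nat -> R -> R) :=
  exists B : R, \forall n \near \oo,
    forall (j : nat) (s : R), (j < J n)%N -> Theta tau0 s ->
    forall (d : measure_display) (W : measurableType d) (Q : probability W R)
        (e : 'I_n -> {mfun W >-> R}), gaussian_noise Q e ->
    ('E_Q[fun w =>
        ((@That n j (curve sigma (f j) s (fun i => e i w)) - s) ^+ 2)%R]
     <= B%:E)%E.

(* Kernel estimator of the density based on m estimated shifts. *)
Definition kernel_estimator (K : R -> R) (h : R) (m : nat) (th : 'I_m -> R)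
    (x : R) : R :=
  (m%:R * h)^-1 * \sum_(j < m) K ((x - th j) / h).

Definition density_estimator (f : nat -> R -> R) (K : R -> R) (n : nat) (h : R)
    (theta : nat -> R) (eps : nat -> nat -> R) : R -> R :=
  kernel_estimator K h (fun j : 'I_(J n) =>
    @That n j (curve sigma (f j) (theta j) (fun i : 'I_n => eps i j))).

Definition cutoff (b : R) (n : nat) : R :=
  (n%:R / ln n%:R) `^ ((2 * b + 1) / (b + 2)).

End estimators.

(* A statistical experiment with parameter phi: under P phi the shifts have
   density phi. *)
Definition maximal_risk (R : realType) (d : measure_display)
    (Omega : measurableType d) (P : (R -> R) -> probability Omega R)
    (X : set R) (H : set (R -> R)) (est : Omega -> R -> R) : \bar R :=
  ereal_sup [set ereal_sup [set ('E_(P phi)[fun w => ((est w x - phi x) ^+ 2)%R])%E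
                           | phi in H] | x in X].

(* Main.v *)
Require Import Defs.
From HB Require Import structures.
From mathcomp Require Import all_boot all_order all_algebra.
From mathcomp Require Import all_classical all_reals all_analysis.
From mathcomp Require Import measurable_realfun.
From mathcomp Require Import ring lra.

Set Implicit Arguments.
Unset Strict Implicit.
Unset Printing Implicit Defensive.

Import Order.TTheory GRing.Theory Num.Theory.
Import numFieldNormedType.Exports.

Local Open Scope classical_set_scope.
Local Open Scope ring_scope.

(** The estimator averages the variables U_j = K((x - That_j) / h), which are
    independent because U_j only depends on the shift and the errors of the
    j-th curve. Its mean square error is therefore at most
    max_j E[U_j^2] / (m h^2) plus the square of the bias max_j |E[U_j] / h -
    phi x|, and both terms are controlled by conditioning on the shift, that
    is, by freezing theta_j at s and integrating over the errors only; the
    product structure of the joint law and Fubini's theorem then give back the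
    full expectation ([indep_Rintegral]).

    For a frozen shift s, let D be the estimation error. A second-order
    expansion of K around (x - s) / h gives a first-order term proportional
    to E[D] / h, of order r / h with r = ln n / n thanks to the bias control,
    and a second-order term of order (D / h)^2, that is r / h^2 on the event
    |D| <= c sqrt r ([kernel_perturbation]). The second-order term is present
    only when s lies within O(h) of x, an event of probability O(h) since phi
    is bounded by M. Taking K0 = sqrt (2 / c2) in the deviation bound makes the
    complementary event of probability O(n^-2), and on that event |D| is
    absorbed by D^2 / n + n, whose expectation is O(1 / n) since the mean
    square error is bounded. After integration over s and division by h, the
    plug-in bias is O(r / h^2), to which the classical O(h^beta) bias of a
    kernel of order l on a Holder class is added ([kernel_bias]).

    Altogether, the risk is O((h^beta + r / h^2)^2 + 1 / (m h)). The bandwidth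
    h = max (m^(-1/(2 beta + 1)), r^(1/(beta + 2))), up to replacing m by
    m + 1, ensures both r <= h^(beta + 2) and 1 / m = O(h^(2 beta + 1)), so
    that the risk is O(h^(2 beta)) in all regimes ([risk_rate]). The condition
    comparing m with the cutoff only decides which of the two arguments of the
    maximum dominates, hence the two rates. *)

(** * Taylor expansions and functions vanishing outside a segment *)

Section taylor.
Variable R : realType.
Implicit Types f g : R -> R.

Lemma derive1nSr g k : derive1n k.+1 g = derive1n k (derive1 g).
Proof. by rewrite /derive1n iterSr. Qed.

Lemma derivable_continuous g : (forall x, derivable g x 1) -> continuous g.
Proof. by move=> dg x; exact/differentiable_continuous/derivable1_diffP. Qed.

Lemma continuous_mul f g : continuous f -> continuous g ->
  continuous (fun u : R => f u * g u).
Proof. by move=> cf cg u; exact: (continuousM (cf u) (cg u)). Qed.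

Lemma continuous_comp_fun f g : continuous f -> continuous g ->
  continuous (fun u : R => g (f u) : R).
Proof. by move=> cf cg u; exact: (continuous_comp (cf u) (cg (f u))). Qed.

Definition taylor_poly g (l : nat) (x v : R) : R :=
  \sum_(k < l.+1) derive1n k g x * v ^+ k / k`!%:R.

Lemma taylor_polyS g l x v :
  taylor_poly g l.+1 x v = taylor_poly g l x v
    + derive1n l.+1 g x * v ^+ l.+1 / l.+1`!%:R.
Proof. by rewrite /taylor_poly big_ord_recr. Qed.

(** The derivative in v of the Taylor polynomial of g is the Taylor polynomial
    of g', one degree lower: this drives the induction on the order below. *)
Lemma is_derive_taylor_poly g (l : nat) (x v : R) :
  is_derive v 1 (taylor_poly g l.+1 x) (taylor_poly (derive1 g) l x v).
Proof.
elim: l => [|l IH].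
  have -> : taylor_poly g 1 x = cst (g x) \+ derive1 g x \*: id.
    apply/funext => w; rewrite /taylor_poly 2!big_ord_recr big_ord0.
    by rewrite /= add0r expr0 fact0 divr1 mulr1 expr1 divr1.
  rewrite /taylor_poly big_ord_recr big_ord0.
  rewrite /= add0r expr0 mulr1 fact0 divr1.
  apply: is_derive_eq.
  by rewrite add0r /GRing.scale/= mulr1.
have -> : taylor_poly g l.+2 x = taylor_poly g l.+1 x \+
    (derive1n l.+2 g x / l.+2`!%:R \*: (fun v : R => v ^+ l.+2)).
  by apply/funext => w; rewrite taylor_polyS [in LHS]mulrAC.
have dX : is_derive v (1:R) (fun w : R => w ^+ l.+2) (l.+2%:R * v ^+ l.+1).
  have -> : (fun w : R => w ^+ l.+2) = id ^+ l.+2 by rewrite exprfctE.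
  have := @is_deriveX R _ id l.+2 v 1 1 (is_derive_id v 1).
  by rewrite /GRing.scale/= mulr1.
have := is_deriveD IH (is_deriveZ (derive1n l.+2 g x / l.+2`!%:R) dX).
congr (is_derive _ _ _ _).
rewrite taylor_polyS -derive1nSr; congr (_ + _).
rewrite /GRing.scale/= factS natrM invfM.
have n0 : l.+2%:R != 0 :> R by rewrite pnatr_eq0.
by field; rewrite pnatr_eq0 -lt0n fact_gt0 -natrD pnatr_eq0.
Qed.

Lemma continuous_taylor_poly g l x : continuous (taylor_poly g l x).
Proof.
case: l => [|l]; last first.
  by apply: derivable_continuous => v; have [] := is_derive_taylor_poly g l x v.
have -> : taylor_poly g 0 x = cst (g x).
  apply/funext => w; rewrite /taylor_poly big_ord_recr big_ord0 /= add0r.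
  by rewrite expr0 fact0 mulr1 divr1.
exact: cst_continuous.
Qed.

(** Differentiating the remainder in v lowers the order by one, so the mean
    value theorem applied at each step gives one factor |v|. The constant is L
    instead of the optimal one, which carries a factorial. *)
Lemma taylor_remainder g (l : nat) (L c x v : R) : 0 <= c -> 0 <= L ->
  (forall k y, (k < l)%N -> derivable (derive1n k g) y 1) ->
  (forall y z, `|derive1n l g y - derive1n l g z| <= L * `|y - z| `^ c) ->
  `|g (x + v) - taylor_poly g l x v| <= L * `|v| `^ (c + l%:R).
Proof.
move=> c0 L0; elim: l g v => [|l IH] g v dg hg.
  rewrite /taylor_poly big_ord_recr big_ord0 /= add0r expr0 mulr1 fact0 divr1 addr0.
  by have /= := hg (x + v) x; rewrite addrAC subrr add0r.
have dg' k y : (k < l)%N -> derivable (derive1n k (derive1 g)) y 1.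
  by move=> kl; rewrite -derive1nSr; exact: dg.
have hg' y z : `|derive1n l (derive1 g) y - derive1n l (derive1 g) z|
    <= L * `|y - z| `^ c by rewrite -!derive1nSr.
have {}IH w := IH _ w dg' hg'.
pose r w := g (x + w) - taylor_poly g l.+1 x w.
have dr w : is_derive w (1:R) r (derive1 g (x + w) - taylor_poly (derive1 g) l x w).
  have dgx : derivable g (x + w) 1 by exact: (dg 0).
  have d1 : is_derive w (1:R) (g \o (fun w => x + w)) (derive1 g (x + w)).
    have ds := is_deriveD (is_derive_cst x w (1:R)) (is_derive_id w (1:R)).
    have := is_derive1_comp (DeriveDef dgx (erefl _)) ds.
    by rewrite add0r mulr1 -derive1E.
  exact: (is_deriveB d1 (is_derive_taylor_poly g l x w)).
have r0 : r 0 = 0.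
  rewrite /r addr0 /taylor_poly big_ord_recl /= expr0 fact0 mulr1 divr1.
  by rewrite big1 ?addr0 ?subrr// => i _; rewrite /bump/= add1n expr0n mulr0 mul0r.
have cr (A : set R) : {within A, continuous r}.
  apply: continuous_subspaceT => w; apply/differentiable_continuous/derivable1_diffP.
  by have [] := dr w.
suff [w vw rv] : exists2 w, `|w| <= `|v| &
    r v = (derive1 g (x + w) - taylor_poly (derive1 g) l x w) * v.
  have clge0 : 0 <= c + l%:R by rewrite addr_ge0.
  rewrite -/(r v) rv normrM -natr1 addrA powRD; last first.
    by apply/implyP; rewrite gt_eqF// ltr_wpDl.
  rewrite powRr1// mulrA ler_wpM2r//; apply: (le_trans (IH w)).
  by rewrite ler_wpM2l// ge0_ler_powR// nnegrE.
have [v0|v0|->] := ltrgt0P v.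
- have [w /[!in_itv]/= /andP[w0 wv] e] := @MVT R r _ _ _ v0 (fun w _ => dr w) (cr _).
  exists w; first by rewrite !gtr0_norm ?ltW.
  have {}e : r v - r 0 = _ * (v - 0) := e.
  by move: e; rewrite r0 !subr0.
- have [w /[!in_itv]/= /andP[vw w0] e] := @MVT R r _ _ _ v0 (fun w _ => dr w) (cr _).
  exists w; first by rewrite !ltr0_norm// lerN2 ltW.
  have {}e : r 0 - r v = _ * (0 - v) := e.
  by rewrite -[LHS]opprK -[- r v]sub0r -r0 e sub0r mulrN opprK.
- by exists 0; rewrite ?normr0// r0 mulr0.
Qed.

Lemma derive1_zero_outside g (a : R) : (forall u, a < `|u| -> g u = 0) ->
  forall u, a < `|u| -> derive1 g u = 0.
Proof.
move=> g0 u au; rewrite derive1E -(@derive_cst R R R 0 u 1).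
apply: near_eq_derive.
have : continuous (fun w : R => `|w|) by exact: norm_continuous.
move=> /(_ u) /cvgr_gt /(_ a au); apply: filterS => w; exact: g0.
Qed.

Lemma bounded_zero_outside g (a : R) : 0 <= a -> continuous g ->
  (forall u, a < `|u| -> g u = 0) -> exists2 B, 0 <= B & forall u, `|g u| <= B.
Proof.
move=> a0 cg g0.
have aa : - a <= a by rewrite ge0_cp.
have cng : {within `[- a, a], continuous (fun u => `|g u|)}.
  apply: continuous_subspaceT => u.
  by apply: continuous_comp; [exact: cg|exact: norm_continuous].
have [c _ cmax] := EVT_max aa cng.
exists `|g c| => // u; have [ua|au] := leP `|u| a.
  by apply: cmax; rewrite in_itv/= -ler_norml.
by rewrite g0// normr0.
Qed.

Lemma compactly_supported_zero_outside g : compactly_supported g ->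
  exists2 a : R, 0 < a & forall u, a < `|u| -> g u = 0.
Proof.
move=> /compact_bounded [A [_ cA]]; exists (Num.max A 0 + 1).
  by rewrite ltr_wpDl// le_max lexx orbT.
move=> u; apply: contraPP => /eqP gu0; apply/negP; rewrite -leNgt.
by apply: cA; [rewrite ltr_pwDr// le_max lexx|exact: subset_closure].
Qed.
End taylor.

(** * Bias of a kernel of order l on a Holder class *)

Section kernel_bias.
Variable R : realType.
Notation mu := (@lebesgue_measure R).
Implicit Types (f g K phi : R -> R) (a h x : R).

Lemma segment_integrable f (b c : R) : continuous f ->
  mu.-integrable `[b, c] (EFin \o f).
Proof.
move=> cf; apply: continuous_compact_integrable; first exact: segment_compact.
exact: continuous_subspaceT.
Qed.

Lemma Rintegral_zero_outside f a : (forall u, a < `|u| -> f u = 0) ->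
  \int[mu]_u f u = \int[mu]_(u in `[- a, a]) f u.
Proof.
move=> f0; rewrite [RHS]Rintegral_mkcond; congr Rintegral.
apply/funext => u; rewrite patchE; case: ifPn => // /negP ua.
by apply: f0; rewrite ltNge; apply/negP => au; apply: ua; rewrite inE/= in_itv/= -ler_norml.
Qed.

Lemma affine_substitution f x h a : 0 < h -> 0 <= a -> continuous f ->
  \int[mu]_(s in `[x - a * h, x + a * h]) f ((x - s) / h)
  = h * \int[mu]_(u in `[- a, a]) f u.
Proof.
move=> h0 a0 cf; pose F s := (x - s) / h.
have dF s : is_derive s (1:R) F (- h^-1).
  have -> : F = h^-1 \*: (cst x - id) by apply/funext => w; rewrite /F mulrC.
  apply: is_derive_eq.
  by rewrite /GRing.scale/= sub0r mulrN mulr1.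
have F' : derive1 F = cst (- h^-1).
  by apply/funext => s; rewrite derive1E; have [_ ->] := dF s.
have cF : continuous F.
  by move=> s; apply/differentiable_continuous/derivable1_diffP; have [] := dF s.
have le : x - a * h <= x + a * h by rewrite lerD2l ge0_cp// mulr_ge0// ltW.
have Fl : F (x - a * h) = a by rewrite /F; field; rewrite gt_eqF.
have Fr : F (x + a * h) = - a by rewrite /F; field; rewrite gt_eqF.
have := @integration_by_substitution_decreasing R F f _ _ le.
rewrite Fl Fr F' => H.
rewrite [X in _ = _ * X]/Rintegral H; last 6 first.
- move=> s t _ _ st; rewrite /F ltr_pM2r ?invr_gt0//.
  by rewrite ltrD2l ltrN2.
- by move=> s _; exact: cst_continuous.
- exact: is_cvg_cst.
- exact: is_cvg_cst.
- split.
  + by move=> s _; have [] := dF s.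
  + by apply: cvg_at_right_filter; exact: cF.
  + by apply: cvg_at_left_filter; exact: cF.
- exact: continuous_subspaceT.
rewrite -[RHS]/(h * \int[mu]_(s in `[x - a * h, x + a * h]) (f (F s) * - - h^-1)).
have cfF : continuous (f \o F) by move=> s; apply: continuous_comp; [exact: cF|exact: cf].
rewrite RintegralZr//; last exact: segment_integrable.
by rewrite opprK mulrCA divff ?mulr1// gt_eqF.
Qed.

Section bias.
Variables (K phi : R -> R) (a B L b : R).
Hypotheses (a0 : 0 < a) (cK : continuous K) (KB : forall u, `|K u| <= B).
Hypothesis K0 : forall u, a < `|u| -> K u = 0.
Hypotheses (b1 : 1 < b) (L0 : 0 <= L) (Kord : kernel_of_order K (sfloor b)).
Hypothesis phiH : holder b L phi.

Let l := sfloor b.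

Let l_gt0 : (0 < l)%N.
Proof.
have b0 : 0 < b := lt_trans ltr01 b1.
have /andP[_] := sfloor_itv b0.
by rewrite -/l; case: l => // /(lt_le_trans b1); rewrite ltxx.
Qed.

Lemma holder_continuous : continuous phi.
Proof.
have [dphi _] := phiH.
by apply: derivable_continuous => y; exact: (dphi 0%N y l_gt0).
Qed.

(** Since K vanishes outside [-a, a], its moments can be computed there, where
    all the functions involved are continuous. *)
Lemma kernel_moment p : (p <= l)%N ->
  \int[mu]_(u in `[- a, a]) (u ^+ p * K u) = (p == 0)%:R.
Proof.
move=> pl; have [_ K1 Kp] := Kord.
rewrite -Rintegral_zero_outside; last by move=> u /K0 ->; rewrite mulr0.
rewrite /Rintegral; case: p pl => [_|p pl]; last by rewrite Kp.
by under eq_integral do rewrite expr0 mul1r; rewrite K1.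
Qed.

(** The moment conditions cancel all the terms of the Taylor polynomial but the
    constant one. *)
Lemma kernel_taylor_poly x h m : (m <= l)%N ->
  \int[mu]_(u in `[- a, a]) (K u * taylor_poly phi m x (- h * u)) = phi x.
Proof.
have cX k : continuous (fun u : R => u ^+ k * K u).
  by apply: continuous_mul => //; exact: exprn_continuous.
have cT k : continuous (fun u : R => K u * taylor_poly phi k x (- h * u)).
  apply: continuous_mul => //; apply: continuous_comp_fun.
    exact: mulrl_continuous.
  exact: continuous_taylor_poly.
elim: m => [_|m IH ml].
  have m0 : \int[mu]_(u in `[- a, a]) (u ^+ 0 * K u) = 1.
    exact: (kernel_moment (leq0n l)).
  rewrite -[RHS]mulr1 -m0 -RintegralZl//; last first.
    exact: segment_integrable.
  apply: eq_Rintegral => u _; rewrite /taylor_poly big_ord_recr big_ord0 /=.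
  by rewrite add0r expr0 fact0 mulr1 divr1 mul1r mulrC.
pose c := derive1n m.+1 phi x * (- h) ^+ m.+1 / m.+1`!%:R.
have mS : \int[mu]_(u in `[- a, a]) (u ^+ m.+1 * K u) = 0.
  exact: (kernel_moment ml).
rewrite -[RHS]addr0 -[in RHS](IH (ltnW ml)) -[X in _ = _ + X](mulr0 c).
rewrite -[X in _ = _ + _ * X]mS -RintegralZl//; last exact: segment_integrable.
rewrite -RintegralD//; last 2 first.
- exact: segment_integrable.
- apply: segment_integrable; apply: continuous_mul => //.
  exact: cst_continuous.
apply: eq_Rintegral => u _; rewrite taylor_polyS mulrDr; congr (_ + _).
by rewrite exprMn /c; ring.
Qed.

(** After the change of variables u = (x - s) / h, phi x is the integral of
    K against the Taylor polynomial of phi at x, so that only the Taylor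
    remainder is left, and |u| <= a on the support of K. *)
Lemma kernel_bias x h : 0 < h ->
  `|\int[mu]_(s in `[x - a * h, x + a * h]) (K ((x - s) / h) * phi s) - h * phi x|
  <= h * (2 * a * (B * (L * (h * a) `^ b))).
Proof.
move=> h0.
pose G u := K u * phi (x + - h * u).
have cx : continuous (fun u => x + - h * u).
  by move=> u; apply: continuousD; [exact: cst_continuous|exact: mulrl_continuous].
have cG : continuous G.
  apply: continuous_mul => //; apply: continuous_comp_fun; first exact: cx.
  exact: holder_continuous.
have cT : continuous (fun u => K u * taylor_poly phi l x (- h * u)).
  apply: continuous_mul => //; apply: continuous_comp_fun.
    exact: mulrl_continuous.
  exact: continuous_taylor_poly.
have -> : \int[mu]_(s in `[x - a * h, x + a * h]) (K ((x - s) / h) * phi s) =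
    \int[mu]_(s in `[x - a * h, x + a * h]) G ((x - s) / h).
  apply: eq_Rintegral => s _; rewrite /G; congr (_ * phi _).
  by field; rewrite gt_eqF.
rewrite affine_substitution ?(ltW a0)// -mulrBr normrM gtr0_norm// ler_pM2l//.
rewrite -(kernel_taylor_poly x h (leqnn l)) -RintegralB//; last 2 first.
- exact: segment_integrable.
- exact: segment_integrable.
have cR : continuous (fun u => G u - K u * taylor_poly phi l x (- h * u)).
  by move=> u; apply: continuousB; [exact: cG|exact: cT].
apply: (le_trans (le_normr_Rintegral _ _)) => //; first exact: segment_integrable.
have B0 : 0 <= B by exact: le_trans (normr_ge0 _) (KB 0).
have -> : 2 * a * (B * (L * (h * a) `^ b)) =
    \int[mu]_(u in `[- a, a]) (B * (L * (h * a) `^ b)).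
  rewrite Rintegral_cst//= lebesgue_measure_itv/= lte_fin gtrN//.
  by rewrite -EFinB/= opprK mulrC mulr2n mulrDl mul1r.
apply: le_Rintegral => //.
- by apply: segment_integrable; apply: continuous_comp_fun => //; exact: norm_continuous.
- by apply: segment_integrable; exact: cst_continuous.
move=> u /=; rewrite in_itv/= -ler_norml => ua.
rewrite -mulrBr normrM ler_pM//.
have lb : 0 <= b - l%:R.
  by rewrite subr_ge0 ltW//; have /andP[] := sfloor_itv (lt_trans ltr01 b1).
have /le_trans := taylor_remainder x (- h * u) lb L0
  (fun k y kl => phiH.1 k y kl) (fun y z => phiH.2 y z).
apply; rewrite subrK ler_wpM2l// ge0_ler_powR//.
- exact: ltW (lt_trans ltr01 b1).
- by rewrite nnegrE mulr_ge0// ltW.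
- by rewrite normrM normrN (gtr0_norm h0) ler_pM2l.
Qed.
End bias.
End kernel_bias.

(** * Independence of disjoint blocks of variables *)

Section independence.
Context {R : realType} {d : measure_display} {Omega : measurableType d}.
Variable P : probability Omega R.

(** The two sides are finite measures in B of the same total mass, so their
    equality propagates from a pi-system to the sigma-algebra it generates. *)
Lemma pi_system_indep_g_sigma (G : set (set Omega)) (A : set Omega) :
  G `<=` measurable -> setI_closed G -> G setT -> measurable A ->
  (forall B, G B -> P (A `&` B) = (P A * P B)%E) ->
  forall B, <<s G >> B -> P (A `&` B) = (P A * P B)%E.
Proof.
move=> Gm GI GT mA AG B sB.
have PA : P A = (fine (P A))%:E by rewrite fineK// fin_num_measure.
have PA0 : 0 <= fine (P A) by rewrite fine_ge0.
pose m1 : {measure set Omega -> \bar R} := mrestr P mA.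
pose m2 : {measure set Omega -> \bar R} := mscale (NngNum PA0) P.
have := @g_sigma_algebra_measure_unique _ R Omega G Gm (fun=> setT) (fun=> GT) _ m1 m2 GI.
have E (C : set Omega) : m2 C = (P A * P C)%E by rewrite /m2/= /mscale/= -PA.
rewrite /m1 /= /mrestr => H.
rewrite setIC -E; apply: H => //.
- by apply/seteqP; split=> // w _; exists 0%N.
- by move=> C GC; rewrite setIC AG -?E.
- by move=> _; rewrite setTI (le_lt_trans (probability_le1 _ _))// ltry.
Qed.

Lemma indep_g_sigma (G1 G2 : set (set Omega)) :
  G1 `<=` measurable -> setI_closed G1 -> G1 setT ->
  G2 `<=` measurable -> setI_closed G2 -> G2 setT ->
  (forall A B, G1 A -> G2 B -> P (A `&` B) = (P A * P B)%E) ->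
  forall A B, <<s G1 >> A -> <<s G2 >> B -> P (A `&` B) = (P A * P B)%E.
Proof.
move=> G1m G1I G1T G2m G2I G2T G12 A B sA sB.
have sG1m := smallest_sub (@sigma_algebra_measurable _ Omega) G1m.
have sG2m := smallest_sub (@sigma_algebra_measurable _ Omega) G2m.
rewrite setIC muleC; apply: (@pi_system_indep_g_sigma G1) => //; first exact: sG2m.
move=> C G1C; rewrite setIC muleC; apply: (@pi_system_indep_g_sigma G2) => //.
  exact: G1m.
by move=> D G2D; exact: G12.
Qed.

Section blocks.
Variables (I : finType) (X : I -> {mfun Omega >-> R}).
Hypothesis indep : mutually_independent P X.

(** The events determined coordinatewise by the variables of the block S: a
    pi-system generating the sigma-algebra of the block. *)
Definition block_events (S : {set I}) : set (set Omega) :=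
  [set A | exists2 B : I -> set R, (forall i, measurable (B i)) &
    A = [set w | forall i, i \in S -> B i (X i w)]].

Lemma block_events_measurable S : block_events S `<=` measurable.
Proof.
move=> _ [B mB ->].
have -> : [set w | forall i, i \in S -> B i (X i w)] =
    \bigcap_(i in [set` S]) (X i @^-1` B i) by [].
apply: fin_bigcap_measurable => // i _.
by rewrite -[_ @^-1` _]setTI; exact: measurable_funP.
Qed.

Lemma block_eventsI S : setI_closed (block_events S).
Proof.
move=> _ _ [B mB ->] [C mC ->]; exists (fun i => B i `&` C i).
  by move=> i; exact: measurableI.
apply/seteqP; split=> [w [Bw Cw] i iS|w BCw]; first by split; [exact: Bw|exact: Cw].
by split=> i /BCw[].
Qed.

Lemma block_eventsT S : block_events S setT.
Proof. by exists (fun=> setT) => //; apply/seteqP; split. Qed.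

Lemma block_events_indep (S1 S2 : {set I}) : [disjoint S1 & S2]%B ->
  forall A B, block_events S1 A -> block_events S2 B ->
  P (A `&` B) = (P A * P B)%E.
Proof.
move=> S12 _ _ [B mB ->] [C mC ->].
(* As the blocks are disjoint, both events can be described with the same
   family of Borel sets, and the intersection is an event of S1 :|: S2. *)
pose D i := if i \in S1 then B i else C i.
have mD i : measurable (D i) by rewrite /D; case: ifP.
have DB : [set w | forall i, i \in S1 -> B i (X i w)] =
    [set w | forall i, i \in S1 -> D i (X i w)].
  apply/seteqP; split=> w h i iS; first by rewrite /D iS; exact: h.
  by have := h i iS; rewrite /D iS.
have DC : [set w | forall i, i \in S2 -> C i (X i w)] =
    [set w | forall i, i \in S2 -> D i (X i w)].
  have nS i : i \in S2 -> (i \in S1) = false by move=> iS; rewrite (disjointFl S12).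
  apply/seteqP; split=> w h i iS; first by rewrite /D nS//; exact: h.
  by have := h i iS; rewrite /D nS.
rewrite DB DC (indep S1 mD) (indep S2 mD).
rewrite -bigU//=.
rewrite (eq_bigl (fun i => i \in S1 :|: S2)); last by move=> i; rewrite !inE.
rewrite -(indep (S1 :|: S2) mD); congr (P _).
apply/seteqP; split=> w.
  by move=> [h1 h2] i; rewrite inE => /orP[/h1|/h2].
by move=> h; split=> i iS; apply: h; rewrite inE iS// orbT.
Qed.

Definition block_sigma S : set (set Omega) := <<s block_events S >>.

Lemma block_sigma_indep (S1 S2 : {set I}) : [disjoint S1 & S2]%B ->
  forall A B, block_sigma S1 A -> block_sigma S2 B ->
  P (A `&` B) = (P A * P B)%E.
Proof.
move=> S12; apply: indep_g_sigma.
- exact: block_events_measurable.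
- exact: block_eventsI.
- exact: block_eventsT.
- exact: block_events_measurable.
- exact: block_eventsI.
- exact: block_eventsT.
- exact: block_events_indep.
Qed.

Lemma block_sigma_coord (S : {set I}) i : i \in S ->
  measurable_fun setT (X i : g_sigma_algebraType (block_events S) -> R).
Proof.
move=> iS _ B mB; rewrite setTI; apply: sub_sigma_algebra.
exists (fun k => if k == i then B else setT); first by move=> k; case: ifP.
apply/seteqP; split=> w /=; first by move=> Bw k _; case: eqP => // ->.
by move=> /(_ i iS); rewrite eqxx.
Qed.

End blocks.
End independence.

(** * Expectations of bounded functions of independent variables *)

Section bounded_expectation.
Context {R : realType} {d : measure_display} {Omega : measurableType d}.
Variable P : probability Omega R.

Lemma bounded_integrable (f : Omega -> R) (c : R) : measurable_fun setT f ->
  (forall w, `|f w| <= c) -> P.-integrable setT (EFin \o f).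
Proof.
move=> mf fc; apply: measurable_bounded_integrable => //.
  by rewrite (le_lt_trans (probability_le1 _ _))// ltry.
exists c; split; first exact: num_real.
by move=> y cy w _ /=; exact: le_trans (fc w) (ltW cy).
Qed.

Lemma Rintegral_prob_cst (c : R) : \int[P]_w c = c.
Proof.
by rewrite Rintegral_cst//= probability_setT mulr1.
Qed.

Lemma bounded_Rintegral_le (f : Omega -> R) (c : R) : measurable_fun setT f ->
  (forall w, `|f w| <= c) -> `|\int[P]_w f w| <= c.
Proof.
move=> mf fc; apply: (le_trans (le_normr_Rintegral _ (bounded_integrable mf fc))) => //.
rewrite -[leRHS]Rintegral_prob_cst; apply: le_Rintegral => //.
- apply: (@bounded_integrable _ c); first exact: measurableT_comp.
  by move=> w; rewrite normr_id.
- by apply: (@bounded_integrable _ `|c|).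
Qed.

Lemma EFin_Rintegral (f : Omega -> R) : P.-integrable setT (EFin \o f) ->
  (\int[P]_w f w)%:E = (\int[P]_w (f w)%:E)%E.
Proof. by move=> fi; rewrite /Rintegral fineK// integrable_fin_num. Qed.

Lemma integrable_EFinD (f g : Omega -> R) :
  P.-integrable setT (EFin \o f) -> P.-integrable setT (EFin \o g) ->
  P.-integrable setT (EFin \o (fun w => f w + g w)).
Proof. by move=> fi gi; have := integrableD measurableT fi gi. Qed.

Lemma integrable_EFinB (f g : Omega -> R) :
  P.-integrable setT (EFin \o f) -> P.-integrable setT (EFin \o g) ->
  P.-integrable setT (EFin \o (fun w => f w - g w)).
Proof. by move=> fi gi; have := integrableB measurableT fi gi. Qed.

Lemma integrable_EFinZ (c : R) (f : Omega -> R) :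
  P.-integrable setT (EFin \o f) ->
  P.-integrable setT (EFin \o (fun w => c * f w)).
Proof. by move=> fi; have := integrableZl measurableT c fi. Qed.

Section joint_law.
Context {d1 d2 : measure_display} {T1 : measurableType d1} {T2 : measurableType d2}.
Variables (X : Omega -> T1) (Y : Omega -> T2).
Hypotheses (mX : measurable_fun setT X) (mY : measurable_fun setT Y).
Hypothesis XY : forall A B, measurable A -> measurable B ->
  P (X @^-1` A `&` Y @^-1` B) = (P (X @^-1` A) * P (Y @^-1` B))%E.

(** By independence the law of (X, Y) is the product of the laws of X and Y, so
    that Fubini's theorem applies: conditioning on X amounts to freezing it. *)
Lemma indep_Rintegral (g : T1 * T2 -> R) (c : R) : measurable_fun setT g ->
  (forall z, `|g z| <= c) ->
  measurable_fun setT (fun w => \int[P]_w' g (X w, Y w')) /\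
  \int[P]_w g (X w, Y w) = \int[P]_w \int[P]_w' g (X w, Y w').
Proof.
move=> mg gc.
pose X' : {mfun Omega >-> T1} := HB.pack X (isMeasurableFun.Build _ _ _ _ X mX).
pose Y' : {mfun Omega >-> T2} := HB.pack Y (isMeasurableFun.Build _ _ _ _ Y mY).
pose Z w := (X w, Y w).
have mZ : measurable_fun setT Z by exact: measurable_fun_pair.
pose Z' : {mfun Omega >-> (T1 * T2)%type} := HB.pack Z (isMeasurableFun.Build _ _ _ _ Z mZ).
have gE := (measurable_EFinP setT g).2 mg.
have mgx x : measurable_fun setT (fun w => g (x, Y w)).
  by apply: measurableT_comp => //; exact: measurable_fun_pair.
have gxi x : P.-integrable setT (fun w => (g (x, Y w))%:E).
  by apply: (bounded_integrable (mgx x) (c := c)).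
have law : forall A, measurable A ->
    (distribution P X' \x distribution P Y')%E A = distribution P Z' A.
  apply: product_measure_unique => A B mA mB.
  exact: XY.
have int_g : (distribution P X' \x distribution P Y')%E.-integrable setT (fun z : T1 * T2 => (g z)%:E).
  apply: measurable_bounded_integrable => //.
    rewrite [ltLHS](law setT measurableT) /distribution/= /pushforward/=.
    by rewrite preimage_setT probability_setT ltry.
  exists c; split; first exact: num_real.
  by move=> y cy w _ /=; exact: le_trans (gc w) (ltW cy).
have FE x : (fubini_F (distribution P Y') (fun z : T1 * T2 => (g z)%:E)) x = (\int[P]_w' g (x, Y w'))%:E.
  rewrite /fubini_F integral_distribution//=.
  - by rewrite (EFin_Rintegral (f := fun w' => g (x, Y w')))//; exact: gxi.
  - exact: measurableT_comp gE (pair1_measurable x).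
  - exact: gxi.
have mF : measurable_fun setT (fun x => \int[P]_w' g (x, Y w')).
  apply/measurable_EFinP.
  rewrite [X in measurable_fun _ X](_ : _ = fubini_F (distribution P Y') (fun z : T1 * T2 => (g z)%:E)).
    exact: (measurable_fubini_F int_g).
  by apply/funext => t; rewrite FE.
split; first exact: (measurableT_comp mF mX).
apply: EFin_inj; rewrite !EFin_Rintegral; last 2 first.
- apply: (@bounded_integrable _ c); first exact: (measurableT_comp mF mX).
  by move=> w; exact: bounded_Rintegral_le.
- by apply: (@bounded_integrable _ c) => //; exact: measurableT_comp.
transitivity (\int[distribution P Z']_z (g z)%:E)%E.
  rewrite integral_distribution//.
  by apply: (@bounded_integrable _ c) => //; exact: measurableT_comp.
transitivity (\int[distribution P X' \x distribution P Y']_z (g z)%:E)%E.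
  by apply: eq_measure_integral => A mA _; exact/esym/law.
rewrite -(integral12_prod_meas1 int_g).
rewrite (_ : fubini_F _ _ = (fun x => (\int[P]_w' g (x, Y w'))%:E)); last first.
  by apply/funext => t; rewrite FE.
rewrite integral_distribution//; first exact/measurable_EFinP.
apply: (@bounded_integrable _ c); first exact: (measurableT_comp mF mX).
by move=> w; exact: bounded_Rintegral_le.
Qed.
End joint_law.
End bounded_expectation.

(** * Densities and averages of uncorrelated variables *)

Section density.
Context {R : realType} {d : measure_display} {Omega : measurableType d}.
Variable P : probability Omega R.
Notation mu := (@lebesgue_measure R).

(** phi is a version of the Radon-Nikodym derivative of the law of X. *)
Lemma density_Rintegral (X : {mfun Omega >-> R}) (phi g : R -> R) (c : R) :
  has_density P X phi -> measurable_fun setT phi ->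
  measurable_fun setT g -> (forall x, `|g x| <= c) ->
  \int[P]_w g (X w) = \int[mu]_x (g x * phi x).
Proof.
move=> Xphi mphi mg gc.
(* The Lebesgue measure lives on GR, which has the same measurable sets as R
   but another display: the law of X has to be taken there. *)
pose GR := measurableTypeR R.
have mX : measurable_fun setT (X : Omega -> GR).
  by move=> _ B mB; rewrite setTI; exact: (@measurable_funPTI _ _ _ _ X B mB).
pose X' : {mfun Omega >-> GR} := HB.pack (X : Omega -> GR) (isMeasurableFun.Build _ _ _ _ (X : Omega -> GR) mX).
pose nu : {finite_measure set GR -> \bar R} := distribution P X'.
have mphi' : measurable_fun setT (phi : GR -> R) by exact: mphi.
have mg' : measurable_fun setT (g : GR -> R) by exact: mg.
have numu : nu `<< mu.
  apply/null_content_dominatesP => A mA A0.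
  transitivity (\int[mu]_(x in A) (phi x)%:E)%E; first exact: Xphi.
  by apply: null_set_integral => //; apply/measurable_EFinP; exact: measurable_funTS.
have RNphi : ae_eq mu setT (Radon_Nikodym (charge_of_finite_measure nu) (mu : {sigma_finite_measure set GR -> \bar R})) (EFin \o phi).
  apply: integral_ae_eq => //.
  - exact: Radon_Nikodym_integrable.
  - exact/measurable_EFinP.
  - move=> A _ mA; rewrite -Radon_Nikodym_integral//; exact: Xphi.
have mgX : measurable_fun setT (fun w => g (X w)) by exact: measurableT_comp.
have gX : P.-integrable setT ((EFin \o g) \o X').
  have := bounded_integrable P mgX (fun w => gc (X w)); exact: id.
have gnu : nu.-integrable setT (EFin \o g).
  by apply: integrable_pushforward => //; exact/measurable_EFinP.
rewrite /Rintegral; congr fine.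
have mEg : measurable_fun setT (EFin \o (g : GR -> R)) by exact/measurable_EFinP.
rewrite -[LHS](integral_distribution mEg gX).
rewrite -[LHS](Radon_Nikodym_change_of_variables numu measurableT gnu).
apply: ae_eq_integral => //.
- apply: emeasurable_funM; first exact/measurable_EFinP.
  by apply: (measurable_int mu); exact: Radon_Nikodym_integrable.
- by apply/measurable_EFinP; exact: measurable_funM.
- by apply: filterS RNphi => x /(_ I) xE _ /=; rewrite xE// EFinM.
Qed.

Definition bounded_mfun (f : Omega -> R) :=
  measurable_fun setT f /\ exists c, forall w, `|f w| <= c.

Lemma bounded_mfun_cst (c : R) : bounded_mfun (fun=> c).
Proof. by split; [exact: measurable_cst|exists `|c|]. Qed.

Lemma bounded_mfunD f g : bounded_mfun f -> bounded_mfun g ->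
  bounded_mfun (fun w => f w + g w).
Proof.
move=> [mf [c fc]] [mg [e ge]]; split; first exact: measurable_funD.
by exists (c + e) => w; rewrite (le_trans (ler_normD _ _))// lerD.
Qed.

Lemma bounded_mfunM f g : bounded_mfun f -> bounded_mfun g ->
  bounded_mfun (fun w => f w * g w).
Proof.
move=> [mf [c fc]] [mg [e ge]]; split; first exact: measurable_funM.
by exists (c * e) => w; rewrite normrM ler_pM.
Qed.

Lemma bounded_mfun_integrable f : bounded_mfun f -> P.-integrable setT (EFin \o f).
Proof. by move=> [mf [c fc]]; exact: (bounded_integrable P mf fc). Qed.

Lemma bounded_mfun_sum (U : nat -> Omega -> R) k :
  (forall j, (j < k)%N -> bounded_mfun (U j)) ->
  bounded_mfun (fun w => \sum_(j < k) U j w).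
Proof.
elim: k => [_|k IH bU].
  by under eq_fun do rewrite big_ord0; exact: bounded_mfun_cst.
under eq_fun do rewrite big_ord_recr; apply: bounded_mfunD => /=.
  by apply: IH => j jk; apply: bU; exact: ltnW.
exact: bU.
Qed.

(** Bias-variance decomposition: centering the U j makes the cross terms vanish,
    so that the variance of the average is of order 1 / m. *)
Lemma mean_square_uncorrelated (m : nat) (U : nat -> Omega -> R) (t b v : R) :
  (0 < m)%N -> (forall j, (j < m)%N -> bounded_mfun (U j)) ->
  (forall j k, (j < m)%N -> (k < m)%N -> j != k ->
    \int[P]_w (U j w * U k w) = \int[P]_w U j w * \int[P]_w U k w) ->
  (forall j, (j < m)%N -> \int[P]_w (U j w) ^+ 2 <= v) ->
  (forall j, (j < m)%N -> `|\int[P]_w U j w - t| <= b) ->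
  \int[P]_w (m%:R^-1 * \sum_(j < m) U j w - t) ^+ 2 <= v / m%:R + b ^+ 2.
Proof.
move=> m0 bU uncor Uv Ub.
have ED f g : bounded_mfun f -> bounded_mfun g ->
    \int[P]_w (f w + g w) = \int[P]_w f w + \int[P]_w g w.
  by move=> bf bg; apply: RintegralD => //; exact: bounded_mfun_integrable.
have EZ c f : bounded_mfun f -> \int[P]_w (c * f w) = c * \int[P]_w f w.
  by move=> bf; apply: RintegralZl => //; exact: bounded_mfun_integrable.
pose e j := \int[P]_w U j w.
pose W j w := U j w + - e j.
have bW j : (j < m)%N -> bounded_mfun (W j).
  by move=> jm; apply: bounded_mfunD; [exact: bU|exact: bounded_mfun_cst].
have EW j : (j < m)%N -> \int[P]_w W j w = 0.
  move=> jm; rewrite ED ?Rintegral_prob_cst ?subrr//; first exact: bU.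
  exact: bounded_mfun_cst.
have bC := bounded_mfun_cst.
have WW j k : (j < m)%N -> (k < m)%N -> \int[P]_w (W j w * W k w) =
    \int[P]_w (U j w * U k w) - e j * e k.
  move=> jm km.
  have bUj := bU _ jm; have bUk := bU _ km.
  transitivity (\int[P]_w (U j w * U k w + (- e k * U j w + (- e j * U k w + e j * e k)))).
    by apply: eq_Rintegral => w _; rewrite /W; ring.
  do 3! (rewrite ED; [|do ?[exact: bC|assumption|apply: bounded_mfunM|apply: bounded_mfunD]..]).
  by rewrite !EZ// Rintegral_prob_cst -/(e j) -/(e k); ring.
have EWW j k : (j < m)%N -> (k < m)%N -> j != k -> \int[P]_w (W j w * W k w) = 0.
  by move=> jm km jk; rewrite WW// uncor// subrr.
have EW2 j : (j < m)%N -> \int[P]_w (W j w * W j w) <= v.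
  move=> jm; rewrite WW//; apply: (le_trans _ (Uv j jm)).
  have -> : \int[P]_w (U j w * U j w) = \int[P]_w (U j w) ^+ 2 by [].
  by rewrite lerBlDr lerDl -expr2 sqr_ge0.
pose S k w := \sum_(j < k) W j w.
have bS k : (k <= m)%N -> bounded_mfun (S k).
  by move=> km; apply: bounded_mfun_sum => j jk; apply: bW; exact: leq_trans km.
have SS k w : S k.+1 w = S k w + W k w by rewrite /S big_ord_recr.
have S0 w : S 0 w = 0 by rewrite /S big_ord0.
have ES k : (k <= m)%N -> \int[P]_w S k w = 0.
  elim: k => [_|k IH km].
    by under eq_Rintegral do rewrite S0; rewrite Rintegral_prob_cst.
  under eq_Rintegral do rewrite SS.
  by rewrite ED ?IH ?EW ?addr0//; [exact: ltnW|exact: bS (ltnW km)|exact: bW].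
have ESW k j : (k <= j)%N -> (j < m)%N -> \int[P]_w (S k w * W j w) = 0.
  elim: k => [_ _|k IH kj jm].
    by under eq_Rintegral do rewrite S0 mul0r; rewrite Rintegral_prob_cst.
  have km := leq_trans kj (ltnW jm).
  under eq_Rintegral do rewrite SS mulrDl.
  rewrite ED ?IH ?EWW ?addr0//.
  - by rewrite neq_ltn kj.
  - exact: ltnW.
  - by apply: bounded_mfunM; [exact: bS (ltnW km)|exact: bW].
  - by apply: bounded_mfunM; exact: bW.
have ES2 k : (k <= m)%N -> \int[P]_w (S k w * S k w) <= k%:R * v.
  elim: k => [_|k IH km].
    by under eq_Rintegral do rewrite S0 mul0r; rewrite Rintegral_prob_cst mul0r.
  have bSk := bS _ (ltnW km); have bWk := bW _ km.
  have -> : \int[P]_w (S k.+1 w * S k.+1 w) =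
      \int[P]_w (S k w * S k w + (2 * (S k w * W k w) + W k w * W k w)).
    by apply: eq_Rintegral => w _; rewrite SS; ring.
  do 2! (rewrite ED; [|do ?[exact: bC|assumption|apply: bounded_mfunM|apply: bounded_mfunD]..]).
  rewrite EZ; last by apply: bounded_mfunM.
  by rewrite ESW// mulr0 add0r -natr1 mulrDl mul1r lerD ?IH ?EW2 ?(ltnW km).
pose A := m%:R^-1 * \sum_(j < m) (e j - t).
have mR : 0 < m%:R :> R by rewrite ltr0n.
have AE w : m%:R^-1 * \sum_(j < m) U j w - t = m%:R^-1 * S m w + A.
  rewrite /A -mulrDr /S -big_split/=.
  under [in RHS]eq_bigr do rewrite /W addrA subrK.
  by rewrite sumrB mulrBr sumr_const card_ord -[t *+ m]mulr_natl mulKf ?gt_eqF.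
have Ab : `|A| <= b.
  rewrite /A normrM gtr0_norm ?invr_gt0// ler_pdivrMl//.
  apply: (le_trans (ler_norm_sum _ _ _)); rewrite mulr_natl.
  have -> : b *+ m = \sum_(j < m) b by rewrite sumr_const card_ord.
  by apply: ler_sum => j _; exact: Ub.
have -> : \int[P]_w (m%:R^-1 * \sum_(j < m) U j w - t) ^+ 2 =
   \int[P]_w (m%:R^-1 ^+ 2 * (S m w * S m w) + (2 * A * m%:R^-1 * S m w + A ^+ 2)).
  by apply: eq_Rintegral => w _; rewrite AE; ring.
have bSm := bS _ (leqnn m).
do 2! (rewrite ED; [|do ?[exact: bC|assumption|apply: bounded_mfunM|apply: bounded_mfunD]..]).
rewrite !EZ//; last exact: bounded_mfunM.
rewrite ES// mulr0 add0r Rintegral_prob_cst lerD//.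
  apply: (@le_trans _ _ (m%:R^-1 ^+ 2 * (m%:R * v))).
    by rewrite ler_wpM2l ?sqr_ge0// ES2.
  by rewrite expr2 -mulrA mulKf ?gt_eqF// mulrC.
rewrite -[leLHS]real_normK ?num_real// lerXn2r// nnegrE.
exact: le_trans Ab.
Qed.
End density.

(** * Kernels evaluated at a perturbed point *)

Section kernel_facts.
Context {R : realType}.

(** All that the proof uses of a smooth compactly supported kernel: a support
    radius a, and a constant B bounding K, K' and the second-order remainder. *)
Definition kernel_bounds (K : R -> R) (a B : R) :=
  [/\ 0 < a, 0 <= B,
      forall u, a < `|u| -> K u = 0 /\ derive1 K u = 0,
      forall u, `|K u| <= B /\ `|derive1 K u| <= B
    & forall u v, `|K (u + v) - K u - derive1 K u * v| <= B * v ^+ 2].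

Lemma derivable_lipschitz (g : R -> R) (B : R) : (forall x, derivable g x 1) ->
  (forall x, `|derive1 g x| <= B) -> forall x y, `|g x - g y| <= B * `|x - y|.
Proof.
move=> dg gB x y; wlog xy : x y / y <= x.
  by have [/[swap]h /h//|/ltW yx /(_ _ _ yx)] := leP y x; rewrite distrC [`|y - x|]distrC.
have dg' z : z \in `]y, x[%R -> is_derive z 1 g (derive1 g z).
  by move=> _; rewrite derive1E; exact: DeriveDef.
have cg : {within `[y, x], continuous g}.
  by apply: continuous_subspaceT; exact: derivable_continuous.
have [c _ ->] := MVT_segment xy dg' cg.
by rewrite normrM ler_wpM2r.
Qed.

Lemma smooth_kernel_bounds (K : R -> R) : smooth K -> compactly_supported K ->
  exists a B, kernel_bounds K a B.
Proof.
move=> sK /compactly_supported_zero_outside[a a0 K0].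
have dK x : derivable K x 1 by exact: (sK 0%N x).
have dK' x : derivable (derive1 K) x 1 by exact: (sK 1%N x).
have dK'' x : derivable (derive1 (derive1 K)) x 1 by exact: (sK 2%N x).
have K'0 := derive1_zero_outside K0.
have K''0 := derive1_zero_outside K'0.
have [B0 B0_ge0 KB] := bounded_zero_outside (ltW a0) (derivable_continuous dK) K0.
have [B1 B1_ge0 K'B] := bounded_zero_outside (ltW a0) (derivable_continuous dK') K'0.
have [B2 B2_ge0 K''B] := bounded_zero_outside (ltW a0) (derivable_continuous dK'') K''0.
exists a, (B0 + B1 + B2); split => //.
- by rewrite !addr_ge0.
- by move=> u au; split; [exact: K0|exact: K'0].
- move=> u; split; [apply: (le_trans (KB u))|apply: (le_trans (K'B u))]; lra.
move=> u v.
have lip y z : `|derive1n 1 K y - derive1n 1 K z| <= B2 * `|y - z| `^ 1.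
  by rewrite powRr1//; exact: (derivable_lipschitz dK' K''B).
have dK1 k y : (k < 1)%N -> derivable (derive1n k K) y 1.
  by rewrite ltnS leqn0 => /eqP ->; exact: dK.
have := taylor_remainder u v ler01 B2_ge0 dK1 lip.
have -> : taylor_poly K 1 u v = K u + derive1 K u * v.
  rewrite /taylor_poly 2!big_ord_recr big_ord0 /= add0r.
  by rewrite expr0 fact0 divr1 mulr1 expr1 divr1.
have -> : (1 + 1%:R : R) = 2%:R by [].
rewrite powR_mulrn// real_normK ?num_real// opprD addrA => /le_trans; apply.
by rewrite ler_wpM2r ?sqr_ge0//; lra.
Qed.

End kernel_facts.

Section perturbation.
Context {R : realType} {d : measure_display} {Omega : measurableType d}.
Variable P : probability Omega R.
Variables (K : R -> R) (a B : R).
Hypotheses (KB : kernel_bounds K a B) (mK : measurable_fun setT K).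
Variables (D : Omega -> R) (h delta kappa p m2 : R).
Hypotheses (mD : measurable_fun setT D) (h0 : 0 < h) (dh : delta <= kappa * h).
Hypothesis (kappa0 : 0 <= kappa).
Hypothesis Dp : (P [set w | (delta < `|D w|)%R] <= p%:E)%E.
Hypothesis Dm2 : (\int[P]_w (D w ^+ 2)%:E <= m2%:E)%E.

Let bad := [set w | (delta < `|D w|)%R].

Let mbad : measurable bad.
Proof.
have mD' : measurable_fun setT (fun w => `|D w|) by exact: measurableT_comp.
have -> : bad = (fun w => `|D w|) @^-1` `]delta, +oo[.
  by apply/seteqP; split=> w /=; rewrite in_itv/= andbT.
by rewrite -[_ @^-1` _]setTI; exact: mD'.
Qed.

Let window : set R := `[- (a + kappa), a + kappa].

(** A perturbation of size at most kappa cannot bring u back into the support of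
    the kernel unless u lies in the window. *)
Lemma window_good u v : `|v| <= kappa -> ~ window u -> a < `|u + v| /\ a < `|u|.
Proof.
move=> vk; rewrite /window/= in_itv/= -ler_norml => /negP; rewrite -ltNge => ak.
have := ler_normB (u + v) v; rewrite addrK => uv.
split; first lra.
by rewrite (le_lt_trans _ ak)// lerDl.
Qed.

Lemma P_bad : \int[P]_w \1_bad w <= p.
Proof.
rewrite /Rintegral integral_indic// setIT.
have /fine_le := Dp; apply => //; exact: fin_num_measure.
Qed.

Lemma bad_bounded : bounded_mfun (\1_bad : Omega -> R).
Proof.
split; first exact: measurable_indic.
by exists 1 => w; rewrite indicE; case: (_ \in _); rewrite ?normr1 ?normr0.
Qed.

Lemma good_delta w : ~ bad w -> `|D w / h| <= delta / h /\ `|D w / h| <= kappa.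
Proof.
move=> /negP; rewrite /bad/= -leNgt => Dd.
rewrite normrM [`|h^-1|]gtr0_norm ?invr_gt0//.
by rewrite ler_pM2r ?invr_gt0// Dd ler_pdivrMr// (le_trans Dd dh).
Qed.

(** The window term will give the factor h in the second moment of the
    summands once u is replaced by (x - theta_j) / h. *)
Lemma kernel_square_perturbation u :
  \int[P]_w (K (u - D w / h)) ^+ 2 <= B ^+ 2 * (\1_window u + p).
Proof.
have [a0 B0 K0 KB1 _] := KB.
have bK : bounded_mfun (fun w => K (u - D w / h)).
  split.
    apply: measurableT_comp => //; apply: measurable_funB => //.
    exact: measurable_funM.
  by exists B => w; have [] := KB1 (u - D w / h).
apply: (@le_trans _ _ (\int[P]_w (B ^+ 2 * (\1_window u + \1_bad w)))).
  have bb : bounded_mfun (fun w => B ^+ 2 * (\1_window u + \1_bad w)).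
    apply: bounded_mfunM; first exact: bounded_mfun_cst.
    by apply: bounded_mfunD; [exact: bounded_mfun_cst|exact: bad_bounded].
  apply: le_Rintegral => //.
  - by apply: bounded_mfun_integrable; exact: bounded_mfunM.
  - exact: bounded_mfun_integrable.
  move=> w _.
  have KB2 : K (u - D w / h) ^+ 2 <= B ^+ 2.
    rewrite -[leLHS]real_normK ?num_real// lerXn2r// ?nnegrE//.
    by have [] := KB1 (u - D w / h).
  rewrite !indicE; have [bw|nbw] := boolP (w \in bad).
    apply: (le_trans KB2); rewrite ler_peMr ?sqr_ge0//.
    by case: (u \in window); rewrite /= ?add0r// lerDr.
  rewrite addr0; have [uw|nuw] := boolP (u \in window); first by rewrite mulr1.
  have nb : ~ bad w by move=> bw; move/negP: nbw; apply; exact: mem_set.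
  have nw : ~ window u by move=> bu; move/negP: nuw; apply; exact: mem_set.
  have [_ Dk] := good_delta nb; rewrite -normrN in Dk.
  have [/K0[-> _] _] := window_good Dk nw.
  by rewrite expr0n mulr0.
rewrite RintegralZl//; last first.
  apply: bounded_mfun_integrable.
  by apply: bounded_mfunD; [exact: bounded_mfun_cst|exact: bad_bounded].
rewrite ler_wpM2l ?sqr_ge0// RintegralD//; last 2 first.
- exact/bounded_mfun_integrable/bounded_mfun_cst.
- exact/bounded_mfun_integrable/bad_bounded.
by rewrite Rintegral_prob_cst lerD2l P_bad.
Qed.

Lemma square_integrable : P.-integrable setT (EFin \o (fun w => D w ^+ 2)).
Proof.
apply/integrableP; split; first by apply/measurable_EFinP; exact: measurable_funX.
apply: le_lt_trans (ltry m2); apply: le_trans Dm2.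
rewrite (eq_integral (fun w => (D w ^+ 2)%:E))// => w _ /=.
by rewrite ger0_norm ?sqr_ge0.
Qed.

Lemma D_integrable : P.-integrable setT (EFin \o D).
Proof.
have i1 : P.-integrable setT (EFin \o (fun w => 1 + D w ^+ 2)).
  apply: integrable_EFinD; last exact: square_integrable.
  exact/bounded_mfun_integrable/bounded_mfun_cst.
apply: le_integrable i1 => //; first exact/measurable_EFinP.
move=> w _ /=; rewrite lee_fin [leRHS]ger0_norm ?addr_ge0 ?sqr_ge0//.
rewrite -[X in _ + X]real_normK ?num_real//; nra.
Qed.

(** D / h is expanded to second order. The linear term has to be kept with its
    sign, since the expectation of D is much smaller than its typical size. On
    the bad event, |D| is bounded by (D^2 / N + N) / 2, which only requires a
    bound on the second moment of D. *)
Lemma kernel_perturbation u (N b : R) : 0 < N ->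
  `|\int[P]_w D w| <= b ->
  `|\int[P]_w K (u - D w / h) - K u| <= B * b / h
     + B * (delta / h) ^+ 2 * \1_window u
     + (2 * B + N * B / (2 * h)) * p + B / (2 * h * N) * m2.
Proof.
move=> N0 Db; have [a0 B0 K0 KB1 KB2] := KB; have [h0' N0'] := (ltW h0, ltW N0).
have bK : bounded_mfun (fun w => K (u - D w / h)).
  split.
    apply: measurableT_comp => //; apply: measurable_funB => //.
    exact: measurable_funM.
  by exists B => w; have [] := KB1 (u - D w / h).
pose rem w := K (u - D w / h) - K u + derive1 K u / h * D w.
pose G w := B * (delta / h) ^+ 2 * \1_window u
     + ((2 * B + N * B / (2 * h)) * \1_bad w + B / (2 * h * N) * D w ^+ 2).
have remG w : `|rem w| <= G w.
  have rE : rem w = K (u + - (D w / h)) - K u - derive1 K u * - (D w / h).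
    by rewrite /rem; ring.
  have D2 : 0 <= B / (2 * h * N) * D w ^+ 2.
    by rewrite mulr_ge0 ?sqr_ge0// divr_ge0// !mulr_ge0// ltW.
  rewrite /G !indicE; have [bw|nbw] := boolP (w \in bad); last first.
    have nb : ~ bad w by move=> bw; move/negP: nbw; apply; exact: mem_set.
    have [Dd Dk] := good_delta nb.
    rewrite mulr0 add0r ler_wpDr//.
    have [uw|nuw] := boolP (u \in window).
      rewrite mulr1 rE; apply: (le_trans (KB2 _ _)); rewrite ler_wpM2l// sqrrN.
      rewrite -[leLHS]real_normK ?num_real// lerXn2r// ?nnegrE//.
      exact: le_trans Dd.
    have nw : ~ window u by move=> bu; move/negP: nuw; apply; exact: mem_set.
    rewrite -normrN in Dk.
    have [/K0[Kv _] /K0[Ku K'u]] := window_good Dk nw.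
    by rewrite rE Kv Ku K'u mul0r !subr0 normr0 mulr0.
  rewrite mulr1 ler_wpDl//.
    by apply: mulr_ge0 => //; apply: mulr_ge0 => //; exact: sqr_ge0.
  have [Ku K'u] := KB1 u; have [Kv _] := KB1 (u - D w / h).
  have h1 : `|derive1 K u / h * D w| <= B / h * `|D w|.
    rewrite !normrM [`|h^-1|]gtr0_norm ?invr_gt0// -!mulrA ler_wpM2r//.
    by rewrite mulr_ge0// invr_ge0 ltW.
  apply: (@le_trans _ _ (2 * B + B / h * `|D w|)).
    have h2 := ler_normD (K (u - D w / h) - K u) (derive1 K u / h * D w).
    have h3 := ler_normB (K (u - D w / h)) (K u).
    by rewrite /rem; lra.
  rewrite -addrA lerD2l.
  have -> : N * B / (2 * h) + B / (2 * h * N) * D w ^+ 2 =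
     B / h * ((N ^+ 2 + D w ^+ 2) / (2 * N)).
    by field; rewrite !gt_eqF.
  rewrite ler_wpM2l ?(divr_ge0 B0 (ltW h0))// ler_pdivlMr ?mulr_gt0//.
  rewrite -[D w ^+ 2]real_normK ?num_real//.
  have := sqr_ge0 (`|D w| - N); nra.
have iK := bounded_mfun_integrable P bK.
have iKu := bounded_mfun_integrable P (bounded_mfun_cst (K u)).
have iD : P.-integrable setT (EFin \o (fun w => derive1 K u / h * D w)).
  by apply: integrable_EFinZ; exact: D_integrable.
have iKK : P.-integrable setT (EFin \o (fun w => K (u - D w / h) - K u)).
  exact: integrable_EFinB.
have irem : P.-integrable setT (EFin \o rem) by exact: integrable_EFinD.
have iB c : P.-integrable setT (EFin \o (fun w => c * \1_bad w)).
  by apply/bounded_mfun_integrable/bounded_mfunM; [exact: bounded_mfun_cst|exact: bad_bounded].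
have iD2 c : P.-integrable setT (EFin \o (fun w => c * D w ^+ 2)).
  by apply: integrable_EFinZ; exact: square_integrable.
have iS c e : P.-integrable setT (EFin \o (fun w => c * \1_bad w + e * D w ^+ 2)).
  exact: integrable_EFinD.
have iC c : P.-integrable setT (EFin \o (fun _ : Omega => c)).
  exact: (bounded_mfun_integrable P (bounded_mfun_cst c)).
have iG : P.-integrable setT (EFin \o G) by exact: integrable_EFinD.
have EK : \int[P]_w K (u - D w / h) - K u =
    \int[P]_w rem w - derive1 K u / h * \int[P]_w D w.
  rewrite RintegralD// RintegralB// RintegralZl//; last exact: D_integrable.
  by rewrite Rintegral_prob_cst addrK.
have Erem : `|\int[P]_w rem w| <= B * (delta / h) ^+ 2 * \1_window u
     + (2 * B + N * B / (2 * h)) * p + B / (2 * h * N) * m2.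
  apply: (le_trans (le_normr_Rintegral _ irem)) => //.
  apply: (@le_trans _ _ (\int[P]_w G w)).
    apply: le_Rintegral => //; first exact: (integrable_norm irem).
  rewrite RintegralD// RintegralD// !RintegralZl//; last 2 first.
  - exact: square_integrable.
  - exact/bounded_mfun_integrable/bad_bounded.
  rewrite Rintegral_prob_cst -[leRHS]addrA lerD2l lerD//.
    by apply: ler_wpM2l; [apply: addr_ge0; rewrite ?divr_ge0 ?mulr_ge0|exact: P_bad].
  apply: ler_wpM2l; first by rewrite divr_ge0// !mulr_ge0.
  rewrite -lee_fin EFin_Rintegral//; exact: square_integrable.
have ED : `|derive1 K u / h * \int[P]_w D w| <= B * b / h.
  rewrite mulrAC normrM [`|h^-1|]gtr0_norm ?invr_gt0//.
  rewrite ler_wpM2r ?invr_ge0// normrM ler_pM//.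
  by have [] := KB1 u.
rewrite EK; apply: (le_trans (ler_normB _ _)).
by rewrite addrC -2!(addrA (B * b / h)); apply: lerD.
Qed.

End perturbation.

(** * One curve with an estimated random shift *)

Section one_curve.
Context {R : realType} {d : measure_display} {Omega : measurableType d}.
Variable P : probability Omega R.
Notation mu := (@lebesgue_measure R).
Variables (theta : {mfun Omega >-> R}) (phi : R -> R) (M : R) (Th : set R).
Hypotheses (dens : has_density P theta phi) (phi0 : forall x, 0 <= phi x).
Hypotheses (phiM : forall x, phi x <= M) (mphi : measurable_fun setT phi).
Hypotheses (mTh : measurable Th) (suppphi : [set x | phi x != 0] `<=` Th).

Lemma indicator_expectation (A : set R) : measurable A ->
  \int[P]_w \1_A (theta w) = \int[mu]_(x in A) phi x.
Proof.
move=> mA; have mtA : measurable (theta @^-1` A) by exact: measurable_funPTI.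
have -> : \int[P]_w \1_A (theta w) = \int[P]_w \1_(theta @^-1` A) w.
  by apply: eq_Rintegral => w _; rewrite !indicE.
by rewrite /Rintegral integral_indic// setIT; congr fine; exact: dens.
Qed.

Lemma outside_support : \int[P]_w \1_(~` Th) (theta w) = 0.
Proof.
rewrite indicator_expectation; last exact: measurableC.
rewrite /Rintegral integral0_eq// => x nx; congr EFin; apply/eqP.
by apply: contraPT nx => /suppphi xT; exact.
Qed.

Lemma segment_expectation (x r : R) : 0 <= r ->
  \int[P]_w \1_(`[x - r, x + r]%classic) (theta w) <= M * (2 * r).
Proof.
move=> r0; rewrite indicator_expectation//.
have -> : M * (2 * r) = \int[mu]_(y in `[x - r, x + r]) M.
  rewrite Rintegral_cst//= lebesgue_measure_itv/= lte_fin.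
  have [xr|] := ltP (x - r) (x + r); first by rewrite -EFinB/=; congr (_ * _); ring.
  move=> xr; have -> : r = 0 by lra.
  by rewrite mulr0.
have mI : measurable (`[x - r, x + r]%classic : set R) by exact: measurable_itv.
have Ifin : (mu `[(x - r)%R, (x + r)%R] < +oo)%E.
  by rewrite lebesgue_measure_itv/=; case: ifPn => // _; rewrite -EFinB ltry.
have M0 : 0 <= M by exact: le_trans (phi0 0) (phiM 0).
apply: le_Rintegral => //.
- apply: measurable_bounded_integrable => //; first exact: measurable_funTS.
  exists M; split; first exact: num_real.
  by move=> y My z _ /=; rewrite ger0_norm// (le_trans (phiM z))// ltW.
- apply: measurable_bounded_integrable => //.
  exists M; split; first exact: num_real.
  by move=> y My z _ /=; rewrite ger0_norm// ltW.
Qed.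

Variables (K : R -> R) (a B : R).
Hypotheses (KB : kernel_bounds K a B) (cK : continuous K).

Let mK : measurable_fun setT K.
Proof. exact: continuous_measurable_fun. Qed.

Lemma kernel_expectation (x h : R) : 0 < h ->
  \int[P]_w K ((x - theta w) / h) =
  \int[mu]_(s in `[x - a * h, x + a * h]) (K ((x - s) / h) * phi s).
Proof.
move=> h0; have [a0 B0 K0 KB1 _] := KB.
have mKx : measurable_fun setT (fun s : R => K ((x - s) / h)).
  apply: measurableT_comp => //; apply: measurable_funM => //.
  exact: measurable_funB.
rewrite (density_Rintegral dens mphi mKx (c := B)); last first.
  by move=> s; have [] := KB1 ((x - s) / h).
rewrite [RHS]Rintegral_mkcond; congr Rintegral.
apply/funext => s; rewrite patchE; case: ifPn => // /negP ns.
have [-> _] : K ((x - s) / h) = 0 /\ derive1 K ((x - s) / h) = 0; last by rewrite mul0r.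
apply: K0; rewrite ltNge; apply/negP => sa; apply: ns; rewrite inE/= in_itv/=.
move: sa; rewrite normrM [`|h^-1|]gtr0_norm ?invr_gt0// ler_pdivrMr// ler_norml.
by move=> /andP[s1 s2]; apply/andP; split; lra.
Qed.

Context {d2 : measure_display} {T2 : measurableType d2}.
Variables (E : Omega -> T2) (q : R * T2 -> R).
Hypotheses (mE : measurable_fun setT E) (mq : measurable_fun setT q).
Hypothesis thetaE : forall A A', measurable A -> measurable A' ->
  P (theta @^-1` A `&` E @^-1` A') = (P (theta @^-1` A) * P (E @^-1` A'))%E.
Variables (x h delta kappa p b m2 N : R).
Hypotheses (h0 : 0 < h) (kappa0 : 0 <= kappa) (dh : delta <= kappa * h).
Hypotheses (N0 : 0 < N).
Hypothesis shift_dev : forall s, Th s ->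
  (P [set w | (delta < `|q (s, E w) - s|)%R] <= p%:E)%E.
Hypothesis shift_bias : forall s, Th s -> `|\int[P]_w (q (s, E w) - s)| <= b.
Hypothesis shift_mse : forall s, Th s ->
  (\int[P]_w ((q (s, E w) - s) ^+ 2)%:E <= m2%:E)%E.

Let g (z : R * T2) := K ((x - q z) / h).

Let mg : measurable_fun setT g.
Proof.
apply: measurableT_comp => //; apply: measurable_funM => //.
exact: measurable_funB.
Qed.

Let gB z : `|g z| <= B.
Proof. by have [_ _ _ KB1 _] := KB; have [] := KB1 ((x - q z) / h). Qed.

Let mD s : measurable_fun setT (fun w => q (s, E w) - s).
Proof.
apply: measurable_funB => //; apply: measurableT_comp => //.
exact: measurable_fun_pair.
Qed.

Let gE s w : g (s, E w) = K ((x - s) / h - (q (s, E w) - s) / h).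
Proof. by rewrite /g; congr K; field; rewrite gt_eqF. Qed.

Let window : set R := `[- (a + kappa), a + kappa].

Lemma window_theta : \int[P]_w \1_window ((x - theta w) / h) <= M * (2 * ((a + kappa) * h)).
Proof.
have [a0 _ _ _ _] := KB.
have r0 : 0 <= (a + kappa) * h by rewrite mulr_ge0 ?(ltW h0)// addr_ge0 ?(ltW a0).
rewrite (_ : \int[P]_w \1_window ((x - theta w) / h) =
  \int[P]_w \1_(`[x - (a + kappa) * h, x + (a + kappa) * h]%classic) (theta w)).
  exact: segment_expectation.
apply: eq_Rintegral => w _; rewrite !indicE; congr (nat_of_bool _)%:R.
apply/idP/idP; rewrite !inE /window/= !in_itv/= => /andP[u1 u2]; apply/andP; split.
- by move: u1 u2; rewrite ler_pdivlMr// ler_pdivrMr// => u1 u2; lra.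
- by move: u1 u2; rewrite ler_pdivlMr// ler_pdivrMr// => u1 u2; lra.
- by rewrite ler_pdivlMr//; lra.
- by rewrite ler_pdivrMr//; lra.
Qed.

Let bounded_window : bounded_mfun (fun w => \1_window ((x - theta w) / h) : R).
Proof.
split; last by exists 1 => w; rewrite indicE; case: (_ \in _); rewrite ?normr1 ?normr0.
apply: measurableT_comp; first by apply: measurable_indic; exact: measurable_itv.
by apply: measurable_funM => //; exact: measurable_funB.
Qed.

Let bounded_outside : bounded_mfun (fun w => \1_(~` Th) (theta w) : R).
Proof.
split; last by exists 1 => w; rewrite indicE; case: (_ \in _); rewrite ?normr1 ?normr0.
by apply: measurableT_comp => //; apply: measurable_indic; exact: measurableC.
Qed.

Let mgs s : measurable_fun setT (fun w => g (s, E w)).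
Proof. by apply: measurableT_comp => //; exact: measurable_fun_pair. Qed.

Let bounded_kernel : bounded_mfun (fun w => K ((x - theta w) / h)).
Proof.
split; last by exists B => w; have [_ _ _ KB1 _] := KB; have [] := KB1 ((x - theta w) / h).
apply: measurableT_comp => //; apply: measurable_funM => //.
exact: measurable_funB.
Qed.

(** For a shift frozen in Th, this is the perturbation bound, and integrating
    the window term over the shift brings a factor h. *)
Lemma estimated_kernel_bias :
  `|\int[P]_w g (theta w, E w) - \int[P]_w K ((x - theta w) / h)|
  <= B * b / h + B * (delta / h) ^+ 2 * (M * (2 * ((a + kappa) * h)))
     + (2 * B + N * B / (2 * h)) * p + B / (2 * h * N) * m2.
Proof.
have [a0 B0 K0 KB1 _] := KB.
have [mk ->] := indep_Rintegral (@measurable_funPT _ _ _ _ theta) mE thetaE mg gB.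
set k := fun w => \int[P]_w' g (theta w, E w').
have kB w : `|k w| <= B.
  by apply: bounded_Rintegral_le => //; exact: mgs.
have bk : bounded_mfun k by split => //; exists B.
pose c1 := B * b / h + (2 * B + N * B / (2 * h)) * p + B / (2 * h * N) * m2.
pose c2 := B * (delta / h) ^+ 2.
have c20 : 0 <= c2 by rewrite mulr_ge0// sqr_ge0.
pose c3 := 2 * B + `|c1|.
have bC := bounded_mfun_cst.
(* The last term, of null expectation, makes the bound hold everywhere: c3 is
   large enough for shifts outside Th, where nothing is known about D. *)
pose G w := (c1 + c2 * \1_window ((x - theta w) / h)) + c3 * \1_(~` Th) (theta w).
have bG1 : bounded_mfun (fun w => c2 * \1_window ((x - theta w) / h)) by exact: bounded_mfunM.
have bG2 : bounded_mfun (fun w => c3 * \1_(~` Th) (theta w)) by exact: bounded_mfunM.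
have bG3 : bounded_mfun (fun w => c1 + c2 * \1_window ((x - theta w) / h)) by exact: bounded_mfunD.
have bG : bounded_mfun G by exact: bounded_mfunD.
have kG w : `|k w - K ((x - theta w) / h)| <= G w.
  rewrite /G [X in _ + c3 * X]indicE; have [nT|/negP yT] := boolP (theta w \in ~` Th).
    have [Kx _] := KB1 ((x - theta w) / h).
    apply: (le_trans (ler_normB _ _)); rewrite mulr1 /c3.
    have := kB w; have := ler_norm (- c1); rewrite normrN.
    have : 0 <= c2 * \1_window ((x - theta w) / h) by rewrite mulr_ge0// indicE ler0n.
    lra.
  have sT : Th (theta w) by apply: contrapT => nT; apply: yT; rewrite inE.
  rewrite mulr0 addr0.
  have -> : k w = \int[P]_w' K ((x - theta w) / h - (q (theta w, E w') - theta w) / h).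
    by apply: eq_Rintegral => w' _; exact: gE.
  apply: (le_trans (kernel_perturbation KB mK (mD (theta w)) h0 dh kappa0
    (shift_dev sT) (shift_mse sT) _ N0 (shift_bias sT))).
  by rewrite /c1 /c2 -/window; lra.
rewrite -RintegralB//; last 2 first.
- exact: bounded_mfun_integrable.
- exact: bounded_mfun_integrable.
apply: (le_trans (le_normr_Rintegral _ _)) => //.
  by apply: integrable_EFinB; exact: bounded_mfun_integrable.
apply: (@le_trans _ _ (\int[P]_w G w)).
  apply: le_Rintegral => //; last by move=> w _; exact: kG.
    apply: integrable_norm.
    by apply: integrable_EFinB; exact: bounded_mfun_integrable.
  exact: bounded_mfun_integrable.
rewrite RintegralD//; [|exact: bounded_mfun_integrable..].
rewrite RintegralD//; [|exact: bounded_mfun_integrable..].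
rewrite !RintegralZl//; [|exact: bounded_mfun_integrable..].
rewrite Rintegral_prob_cst outside_support mulr0 addr0.
have : c2 * \int[P]_w \1_window ((x - theta w) / h) <= c2 * (M * (2 * ((a + kappa) * h))).
  by rewrite ler_wpM2l// window_theta.
by rewrite /c1 /c2; lra.
Qed.

Lemma estimated_kernel_square :
  \int[P]_w (g (theta w, E w) ^+ 2) <= B ^+ 2 * (M * (2 * ((a + kappa) * h)) + p).
Proof.
have [a0 B0 K0 KB1 _] := KB.
have mg2 : measurable_fun setT (fun z => g z ^+ 2) by exact: measurable_funX.
have gB2 z : `|g z ^+ 2| <= B ^+ 2.
  by rewrite normrX lerXn2r// nnegrE.
have [mk ->] := indep_Rintegral (@measurable_funPT _ _ _ _ theta) mE thetaE mg2 gB2.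
set k := fun w => \int[P]_w' (g (theta w, E w') ^+ 2).
have kB w : `|k w| <= B ^+ 2.
  by apply: bounded_Rintegral_le => //; apply: measurable_funX; exact: mgs.
have bk : bounded_mfun k by split => //; exists (B ^+ 2).
have bC := bounded_mfun_cst.
pose c3 := B ^+ 2 + `|B ^+ 2 * p|.
pose G w := B ^+ 2 * (\1_window ((x - theta w) / h) + p) + c3 * \1_(~` Th) (theta w).
have bG0 : bounded_mfun (fun w => \1_window ((x - theta w) / h) + p) by exact: bounded_mfunD.
have bG1 : bounded_mfun (fun w => B ^+ 2 * (\1_window ((x - theta w) / h) + p)).
  exact: bounded_mfunM.
have bG2 : bounded_mfun (fun w => c3 * \1_(~` Th) (theta w)) by exact: bounded_mfunM.
have bG : bounded_mfun G by exact: bounded_mfunD.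
have kG w : k w <= G w.
  rewrite /G [X in _ + c3 * X]indicE; have [nT|/negP yT] := boolP (theta w \in ~` Th).
    have := kB w; have := ler_norm (k w); have := ler_norm (- (B ^+ 2 * p)).
    have : 0 <= B ^+ 2 * \1_window ((x - theta w) / h).
      by rewrite mulr_ge0 ?sqr_ge0// indicE ler0n.
    by rewrite normrN mulr1 /c3 mulrDr; lra.
  have sT : Th (theta w) by apply: contrapT => nT; apply: yT; rewrite inE.
  rewrite mulr0 addr0.
  have -> : k w = \int[P]_w' (K ((x - theta w) / h - (q (theta w, E w') - theta w) / h) ^+ 2).
    by apply: eq_Rintegral => w' _; rewrite gE.
  exact: (kernel_square_perturbation KB mK (mD (theta w)) h0 dh kappa0
    (shift_dev sT)).
apply: (@le_trans _ _ (\int[P]_w G w)).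
  apply: le_Rintegral => //; last by move=> w _; exact: kG.
    exact: bounded_mfun_integrable.
  exact: bounded_mfun_integrable.
rewrite RintegralD//; [|exact: bounded_mfun_integrable..].
rewrite !RintegralZl//; [|exact: bounded_mfun_integrable..].
rewrite outside_support mulr0 addr0 RintegralD//; [|exact: bounded_mfun_integrable..].
by rewrite Rintegral_prob_cst ler_wpM2l ?sqr_ge0// lerD2r window_theta.
Qed.

End one_curve.

(** * Independence structure of the curves *)

Section curves.
Context {R : realType} {d : measure_display} {Omega : measurableType d}.
Variable P : probability Omega R.

Lemma measurable_curve_estimator n (T : n.-tuple R -> R) (sigma : R) (g : R -> R) :
  measurable_fun setT T -> measurable_fun setT g ->
  measurable_fun setT (fun z : R * n.-tuple R => T (curve sigma g z.1 (tnth z.2))).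
Proof.
move=> mT mg; apply: measurableT_comp => //.
apply/measurable_fun_tnthP => i.
rewrite (_ : _ \o _ =
  fun z : R * n.-tuple R => g (i.+1%:R / n%:R - z.1) + sigma * tnth z.2 i); last first.
  by apply/funext => z /=; rewrite tnth_mktuple.
apply: measurable_funD.
  by apply: measurableT_comp => //; apply: measurable_funB => //; exact: measurable_fst.
apply: measurable_funM => //.
exact: (measurableT_comp (measurable_tnth i) measurable_snd).
Qed.

Variables (n m : nat) (theta : nat -> {mfun Omega >-> R})
  (eps : nat -> nat -> {mfun Omega >-> R}).
Hypothesis indep : mutually_independent P (@shifts_and_errors R d Omega n m theta eps).

(** The errors of the j-th curve as a random vector of R^n, the space on which
    the estimators of the shifts are defined. *)
Definition errors (j : nat) (w : Omega) : n.-tuple R := [tuple eps i j w | i < n].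

Let X := @shifts_and_errors R d Omega n m theta eps.
Let Idx := ('I_m + 'I_n * 'I_m)%type.

Lemma measurable_errors j : measurable_fun setT (errors j).
Proof.
apply/measurable_fun_tnthP => i.
by rewrite (_ : _ \o _ = eps i j)//; apply/funext => w /=; rewrite tnth_mktuple.
Qed.

Lemma block_errors (S : {set Idx}) (j : 'I_m) : (forall i, inr (i, j) \in S) ->
  measurable_fun setT (errors j : g_sigma_algebraType (block_events X S) -> n.-tuple R).
Proof.
move=> jS; apply/measurable_fun_tnthP => i.
rewrite (_ : _ \o _ = eps i j); last by apply/funext => w /=; rewrite tnth_mktuple.
exact: (block_sigma_coord (X := X) (jS i)).
Qed.

Lemma block_shift (S : {set Idx}) (j : 'I_m) : inl j \in S ->
  measurable_fun setT (theta j : g_sigma_algebraType (block_events X S) -> R).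
Proof. by move=> jS; exact: (block_sigma_coord (X := X) jS). Qed.

Lemma shift_errors_indep j : (j < m)%N -> forall A A', measurable A -> measurable A' ->
  P (theta j @^-1` A `&` errors j @^-1` A') = (P (theta j @^-1` A) * P (errors j @^-1` A'))%E.
Proof.
move=> jm A A' mA mA'; pose j' := Ordinal jm.
pose S1 : {set Idx} := finset (pred1 (inl j')).
pose S2 : {set Idx} := finset (fun k => if k is inr ij then ij.2 == j' else false).
apply: (block_sigma_indep indep (S1 := S1) (S2 := S2)).
- by apply/pred0P => -[l|[i l]] /=; rewrite !inE ?andbF.
- have jS : inl j' \in S1 by rewrite inE /= eqxx.
  by have := block_shift jS measurableT mA; rewrite setTI.
- have jS i : inr (i, j') \in S2 by rewrite inE /= eqxx.
  by have := block_errors jS measurableT mA'; rewrite setTI.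
Qed.

Lemma curves_indep j k : (j < m)%N -> (k < m)%N -> j != k ->
  forall A A', measurable A -> measurable A' ->
  P ((fun w => (theta j w, errors j w)) @^-1` A `&`
     (fun w => (theta k w, errors k w)) @^-1` A') =
  (P ((fun w => (theta j w, errors j w)) @^-1` A) *
   P ((fun w => (theta k w, errors k w)) @^-1` A'))%E.
Proof.
move=> jm km jk A A' mA mA'; pose j' := Ordinal jm; pose k' := Ordinal km.
pose S (l : 'I_m) : {set Idx} :=
  finset (fun i => match i with inl l' => l' == l | inr il => il.2 == l end).
have mS (l : 'I_m) : measurable_fun setT
    ((fun w => (theta l w, errors l w)) : g_sigma_algebraType (block_events X (S l)) -> R * n.-tuple R).
  apply: measurable_fun_pair; first by apply: block_shift; rewrite inE /= eqxx.
  by apply: block_errors => i; rewrite inE /= eqxx.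
apply: (block_sigma_indep indep (S1 := S j') (S2 := S k')).
- have jk' : j' != k' by [].
  by apply/pred0P => -[l|[i l]] /=; rewrite !inE /=; case: eqP => // ->; exact: negbTE.
- by have := mS j' measurableT _ mA; rewrite setTI.
- by have := mS k' measurableT _ mA'; rewrite setTI.
Qed.

(** Under the full model, the errors of one curve are a legitimate noise for the
    conditions on the estimators, which are stated for arbitrary noises. *)
Lemma gaussian_errors j : (j < m)%N ->
  (forall i, (i < n)%N -> standard_normal P (eps i j)) ->
  gaussian_noise P (fun i : 'I_n => eps i j).
Proof.
move=> jm normal; split; first by move=> i; exact: normal.
move=> S B mB; pose j' := Ordinal jm.
pose f (i : 'I_n) : Idx := inr (i, j').
have finj : injective f by move=> i i' [].
pose B' (k : Idx) := if k is inr ij then B ij.1 else setT.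
have mB' k : measurable (B' k) by case: k => [|[]] //=.
have := indep (f @: S) mB'.
rewrite big_imset/=; last by move=> i i' _ _; exact: finj.
move=> <-; congr (P _); apply/seteqP; split=> w h.
  by move=> _ /imsetP[i iS ->]; exact: h.
by move=> i iS; exact: (h (f i) (imset_f f iS)).
Qed.

End curves.

(** * Risk bound for a fixed sample size *)

Section finite_sample.
Context {R : realType} {d : measure_display} {Omega : measurableType d}.
Variable P : probability Omega R.
Notation mu := (@lebesgue_measure R).
Variables (n m : nat) (theta : nat -> {mfun Omega >-> R})
  (eps : nat -> nat -> {mfun Omega >-> R}).
Variables (tau0 M beta L : R) (phi : R -> R).
Hypotheses (beta1 : 1 < beta) (L0 : 0 <= L) (phiH : holder_density tau0 M beta L phi).
Hypotheses (m0 : (0 < m)%N) (model : shift_model P phi n m theta eps).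
Variables (K : R -> R) (a B : R).
Hypotheses (KB : kernel_bounds K a B) (cK : continuous K).
Hypothesis Kord : kernel_of_order K (sfloor beta).
Variables (sigma : R) (f : nat -> R -> R) (T : nat -> n.-tuple R -> R).
Hypotheses (mT : forall j, measurable_fun setT (T j)) (mf : forall j, measurable_fun setT (f j)).
Variables (h delta kappa p b m2 N : R).
Hypotheses (h0 : 0 < h) (kappa0 : 0 <= kappa) (dh : delta <= kappa * h) (N0 : 0 < N).

Let shift_error j s w := T j (curve sigma (f j) s (fun i : 'I_n => eps i j w)) - s.

Hypothesis shift_dev : forall j s, (j < m)%N -> Theta tau0 s ->
  (P [set w | (delta < `|shift_error j s w|)%R] <= p%:E)%E.
Hypothesis shift_bias : forall j s, (j < m)%N -> Theta tau0 s ->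
  (`|'E_P[shift_error j s]| <= b%:E)%E.
Hypothesis shift_mse : forall j s, (j < m)%N -> Theta tau0 s ->
  ('E_P[fun w => (shift_error j s w ^+ 2)%R] <= m2%:E)%E.

Lemma curve_errors j s w : curve sigma (f j) s (tnth (errors n eps j w)) =
  curve sigma (f j) s (fun i : 'I_n => eps i j w).
Proof. by congr curve; apply/funext => i; rewrite tnth_mktuple. Qed.

Lemma measurable_Theta : measurable (Theta tau0).
Proof.
rewrite (_ : Theta tau0 = `[- tau0, tau0]%classic); first exact: measurable_itv.
by apply/seteqP; split=> s; rewrite /Theta/= in_itv.
Qed.

Let q j (z : R * n.-tuple R) := T j (curve sigma (f j) z.1 (tnth z.2)).
Let E j := errors n eps j.

Let qE j s w : q j (s, E j w) - s = shift_error j s w.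
Proof. by rewrite /q /= curve_errors. Qed.

Let mq j : measurable_fun setT (q j).
Proof. exact: measurable_curve_estimator. Qed.

(** The first four terms come from estimating the shifts, the last one from
    smoothing phi at scale h. *)
Definition smoothing_bias : R :=
  B * b / h + B * (delta / h) ^+ 2 * (M * (2 * ((a + kappa) * h)))
  + (2 * B + N * B / (2 * h)) * p + B / (2 * h * N) * m2
  + h * (2 * a * (B * (L * (h * a) `^ beta))).

(** Non-asymptotic bound. The estimator is 1 / h times the average of the U j,
    which estimates h * phi x. *)
Lemma density_estimator_risk x :
  ('E_P[fun w => ((kernel_estimator K h (fun j : 'I_m =>
      T j (curve sigma (f j) (theta j w) (fun i : 'I_n => eps i j w))) x - phi x) ^+ 2)%R]
   <= ((B ^+ 2 * (M * (2 * ((a + kappa) * h)) + p) / m%:R + smoothing_bias ^+ 2)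
        / h ^+ 2)%:E)%E.
Proof.
have [phi0 _ suppphi phihol phiM] := phiH.
have [dens normal indep] := model.
have [a0 B0 K0 KB1 _] := KB.
have cphi := holder_continuous beta1 phihol.
have mphi : measurable_fun setT phi by exact: continuous_measurable_fun.
have mK : measurable_fun setT K by exact: continuous_measurable_fun.
pose g j (z : R * n.-tuple R) := K ((x - q j z) / h).
have mg j : measurable_fun setT (g j).
  apply: measurableT_comp => //; apply: measurable_funM => //.
  exact: measurable_funB.
have gB j z : `|g j z| <= B by have [] := KB1 ((x - q j z) / h).
have mE j : measurable_fun setT (E j) by exact: measurable_errors.
pose U j w := g j (theta j w, E j w).
have mZ j : measurable_fun setT (fun w => (theta j w, E j w)).
  exact: measurable_fun_pair.
have bU j : bounded_mfun (U j).
  by split; [exact: measurableT_comp|exists B => w; exact: gB].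
have dev j : (j < m)%N -> forall s, Theta tau0 s ->
    (P [set w | (delta < `|q j (s, E j w) - s|)%R] <= p%:E)%E.
  move=> jm s sT; under eq_set do rewrite qE; exact: shift_dev.
have mse j : (j < m)%N -> forall s, Theta tau0 s ->
    (\int[P]_w ((q j (s, E j w) - s) ^+ 2)%:E <= m2%:E)%E.
  move=> jm s sT; under eq_integral do rewrite qE.
  by have := shift_mse jm sT; rewrite unlock.
have bias j : (j < m)%N -> forall s, Theta tau0 s ->
    `|\int[P]_w (q j (s, E j w) - s)| <= b.
  move=> jm s sT.
  have mD : measurable_fun setT (fun w => q j (s, E j w) - s).
    apply: measurable_funB => //; apply: measurableT_comp => //.
    exact: measurable_fun_pair.
  have iD := D_integrable mD (mse j jm s sT).
  rewrite -lee_fin EFin_normr_Rintegral//.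
  under eq_integral do rewrite qE.
  by have := shift_bias jm sT; rewrite unlock.
have Ubias j : (j < m)%N -> `|\int[P]_w U j w - h * phi x| <= smoothing_bias.
  move=> jm.
  have H1 := estimated_kernel_bias (dens j jm) phi0 phiM mphi measurable_Theta
    suppphi KB cK (mE j) (mq j) (shift_errors_indep indep jm) x h0 kappa0 dh N0
    (dev j jm) (bias j jm) (mse j jm).
  have KBB u : `|K u| <= B by have [] := KB1 u.
  have K00 u : a < `|u| -> K u = 0 by move=> /K0[].
  have := kernel_bias a0 cK KBB K00 beta1 L0 Kord phihol x h0.
  rewrite -(kernel_expectation (dens j jm) mphi KB cK x h0) => H2.
  rewrite /smoothing_bias; apply: le_trans (lerD H1 H2).
  by rewrite -/(U j _); apply: le_trans (ler_normD _ _); rewrite addrA subrK.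
have Usq j : (j < m)%N ->
    \int[P]_w (U j w) ^+ 2 <= B ^+ 2 * (M * (2 * ((a + kappa) * h)) + p).
  move=> jm.
  exact: (estimated_kernel_square (dens j jm) phi0 phiM mphi measurable_Theta
    suppphi KB cK (mE j) (mq j) (shift_errors_indep indep jm) x h0 kappa0 dh
    (dev j jm)).
have uncor j k : (j < m)%N -> (k < m)%N -> j != k ->
    \int[P]_w (U j w * U k w) = \int[P]_w U j w * \int[P]_w U k w.
  move=> jm km jk.
  pose G (z : (R * n.-tuple R) * (R * n.-tuple R)) := g j z.1 * g k z.2.
  have mG : measurable_fun setT G.
    apply: measurable_funM; first exact: (measurableT_comp (mg j) measurable_fst).
    exact: (measurableT_comp (mg k) measurable_snd).
  have GB z : `|G z| <= B * B by rewrite normrM ler_pM.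
  have [_ ->] := indep_Rintegral (mZ j) (mZ k) (curves_indep indep jm km jk) mG GB.
  rewrite -RintegralZr//; last exact: bounded_mfun_integrable.
  apply: eq_Rintegral => w _; rewrite /G /= -/(U j w).
  by rewrite RintegralZl//; exact: (bounded_mfun_integrable P (bU k)).
have main := mean_square_uncorrelated m0 (fun j _ => bU j) uncor Usq Ubias.
have bS : bounded_mfun (fun w => m%:R^-1 * \sum_(j < m) U j w - h * phi x).
  apply: bounded_mfunD; last exact: bounded_mfun_cst.
  apply: bounded_mfunM; first exact: bounded_mfun_cst.
  exact: bounded_mfun_sum.
have bS2 := bounded_mfunM bS bS.
have -> : (fun w => (kernel_estimator K h (fun j : 'I_m =>
      T j (curve sigma (f j) (theta j w) (fun i : 'I_n => eps i j w))) x - phi x) ^+ 2)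
  = fun w => (h ^+ 2)^-1 * (m%:R^-1 * \sum_(j < m) U j w - h * phi x) ^+ 2.
  apply/funext => w; rewrite /kernel_estimator.
  rewrite (eq_bigr (fun j : 'I_m => U j w)); last first.
    by move=> j _; rewrite /U /g /q /= curve_errors.
  set S := \sum_(j < m) _; field.
  by rewrite pnatr_eq0 -lt0n m0 gt_eqF.
rewrite unlock -EFin_Rintegral; last first.
  by apply: integrable_EFinZ; exact: bounded_mfun_integrable.
rewrite lee_fin RintegralZl//; last exact: (bounded_mfun_integrable P bS2).
by rewrite mulrC ler_wpM2r ?invr_ge0 ?sqr_ge0.
Qed.

End finite_sample.

(** * The bandwidth *)

Section rates.
Context {R : realType}.
Implicit Types (beta u h y r : R).

(** m.+1 keeps the bandwidth positive for m = 0 and changes the rates by a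
    constant factor only. *)
Definition bandwidth beta (n m : nat) : R :=
  Num.max (m.+1%:R `^ (- (2 * beta + 1)^-1))
          ((n%:R / ln n%:R) `^ (- (beta + 2)^-1)).

Lemma bandwidth_gt0 beta n m : 0 < bandwidth beta n m.
Proof. by rewrite /bandwidth lt_max powR_gt0. Qed.

Lemma powR_le1_neg u e : 1 <= u -> 0 <= e -> u `^ (- e) <= 1.
Proof.
move=> u1 e0; rewrite powRN invf_le1 ?powR_gt0 ?(lt_le_trans ltr01)//.
have u0 : 0 <= u by exact: le_trans u1.
have := @ge0_ler_powR _ e e0 1 u; rewrite powR1; apply => //; rewrite nnegrE//.
Qed.

Lemma powR_antitone (u v e : R) : 0 < u -> u <= v -> 0 <= e -> v `^ (- e) <= u `^ (- e).
Proof.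
move=> u0 uv e0; have v0 : 0 < v by exact: lt_le_trans uv.
rewrite !powRN lef_pV2 ?posrE ?powR_gt0// ge0_ler_powR// nnegrE ltW//.
Qed.

Lemma ratio_ge1 (n : nat) : 1 <= ln n%:R :> R -> 1 <= n%:R / ln n%:R :> R.
Proof.
move=> ln1; have n0 : (0 < n)%N.
  by rewrite lt0n; apply: contraTneq ln1 => ->; rewrite ln0// -ltNge ltr01.
rewrite ler_pdivlMr ?mul1r ?(lt_le_trans ltr01)//.
have n0' : 0 < n%:R :> R by rewrite ltr0n.
rewrite -[leRHS](lnK n0'); apply: le_trans (expR_ge1Dx _).
by rewrite lerDr ler01.
Qed.

(** The two lower bounds on the bandwidth hold because it is a maximum; they
    say that the plug-in bias is dominated by the smoothing bias, and the
    variance by its square. *)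
Lemma bandwidth_spec beta n m : 1 < beta -> 1 <= ln n%:R :> R ->
  let h := bandwidth beta n m in
  [/\ h <= 1, ln n%:R / n%:R <= h `^ beta * h ^+ 2
    & m.+1%:R^-1 <= (h `^ beta) ^+ 2 * h].
Proof.
move=> b1 ln1 h; have u1 := ratio_ge1 ln1; set u := n%:R / ln n%:R in u1.
have u0 : 0 < u := lt_le_trans ltr01 u1.
have h0 : 0 < h := bandwidth_gt0 beta n m.
have e1 : 0 < 2 * beta + 1 by lra.
have e2 : 0 < beta + 2 by lra.
split.
- rewrite /h /bandwidth ge_max -/u !powR_le1_neg ?invr_ge0 ?(ltW e1) ?(ltW e2)//.
  by rewrite ler1n.
- have -> : ln n%:R / n%:R = u^-1 by rewrite /u invf_div.
  have -> : h `^ beta * h ^+ 2 = h `^ (beta + 2).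
    by rewrite powRD ?gt_eqF ?implybT// powR_mulrn// ltW.
  have -> : u^-1 = (u `^ (- (beta + 2)^-1)) `^ (beta + 2).
    by rewrite -powRrM mulNr mulVf ?gt_eqF// powR_inv1// ltW.
  rewrite ge0_ler_powR ?nnegrE ?powR_ge0 ?(ltW e2) ?(ltW h0)//.
  by rewrite /h /bandwidth le_max lexx orbT.
- have -> : (h `^ beta) ^+ 2 * h = h `^ (2 * beta + 1).
    have -> : 2 * beta + 1 = beta * 2%:R + 1 by ring.
    rewrite powRD; last by rewrite (gt_eqF h0) implybT.
    by rewrite powRr1 ?(ltW h0)// powRrM powR_mulrn ?powR_ge0.
  have -> : m.+1%:R^-1 = (m.+1%:R `^ (- (2 * beta + 1)^-1)) `^ (2 * beta + 1) :> R.
    by rewrite -powRrM mulNr mulVf ?gt_eqF// powR_inv1.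
  rewrite ge0_ler_powR ?nnegrE ?powR_ge0 ?(ltW e1) ?(ltW h0)//.
  by rewrite /h /bandwidth le_max lexx.
Qed.

(** Below the cutoff, both terms of the maximum are at most
    m^(-1/(2 beta + 1)). *)
Lemma bandwidth_few_curves beta n m : 1 < beta -> 1 <= ln n%:R :> R -> (0 < m)%N ->
  m%:R <= cutoff beta n ->
  (bandwidth beta n m `^ beta) ^+ 2 <= m%:R `^ (- (2 * beta / (2 * beta + 1))).
Proof.
move=> b1 ln1 m0 mc; have u1 := ratio_ge1 ln1.
rewrite /cutoff in mc; set u := n%:R / ln n%:R in u1 mc.
have u0 : 0 < u := lt_le_trans ltr01 u1.
have e1 : 0 < 2 * beta + 1 by lra.
have e2 : 0 < beta + 2 by lra.
have b0 : 0 <= beta by lra.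
have mR : 0 < m%:R :> R by rewrite ltr0n.
have -> : m%:R `^ (- (2 * beta / (2 * beta + 1))) =
    ((m%:R `^ (- (2 * beta + 1)^-1)) `^ beta) ^+ 2 :> R.
  by rewrite -powR_mulrn ?powR_ge0// -!powRrM; congr (_ `^ _); ring.
rewrite lerXn2r ?nnegrE ?powR_ge0// ge0_ler_powR ?nnegrE ?powR_ge0//.
  exact: ltW (bandwidth_gt0 _ _ _).
rewrite /bandwidth ge_max powR_antitone ?invr_ge0 ?(ltW e1) ?ler_nat//=.
rewrite -/u; have -> : u `^ (- (beta + 2)^-1) =
    (u `^ ((2 * beta + 1) / (beta + 2))) `^ (- (2 * beta + 1)^-1).
  by rewrite -powRrM; congr (_ `^ _); field; rewrite !gt_eqF.
by rewrite powR_antitone// invr_ge0 ltW.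
Qed.

(** Above the cutoff, the maximum is its second term. *)
Lemma bandwidth_many_curves beta n m : 1 < beta -> 1 <= ln n%:R :> R ->
  cutoff beta n <= m%:R ->
  (bandwidth beta n m `^ beta) ^+ 2 <= (n%:R / ln n%:R) `^ (- (2 * beta / (beta + 2))).
Proof.
move=> b1 ln1 mc; have u1 := ratio_ge1 ln1.
rewrite /cutoff in mc; rewrite /bandwidth; set u := n%:R / ln n%:R in u1 mc *.
have u0 : 0 < u := lt_le_trans ltr01 u1.
have e1 : 0 < 2 * beta + 1 by lra.
have e2 : 0 < beta + 2 by lra.
have b0 : 0 <= beta by lra.
have -> : u `^ (- (2 * beta / (beta + 2))) = ((u `^ (- (beta + 2)^-1)) `^ beta) ^+ 2.
  by rewrite -powR_mulrn ?powR_ge0// -!powRrM; congr (_ `^ _); ring.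
have h0 := bandwidth_gt0 beta n m; rewrite /bandwidth -/u in h0.
rewrite lerXn2r ?nnegrE ?powR_ge0// ge0_ler_powR ?nnegrE ?powR_ge0 ?(ltW h0)//.
rewrite ge_max lexx andbT.
have -> : u `^ (- (beta + 2)^-1) =
    (u `^ ((2 * beta + 1) / (beta + 2))) `^ (- (2 * beta + 1)^-1).
  by rewrite -powRrM; congr (_ `^ _); field; rewrite !gt_eqF.
rewrite powR_antitone ?powR_gt0 ?invr_ge0 ?(ltW e1)//.
by apply: (le_trans mc); rewrite ler_nat.
Qed.

End rates.

(** * Rate of the risk bound *)

Section risk_rate.
Context {R : realType}.
Variables (M beta L a B kappa C c1 m2 : R).
Hypotheses (M0 : 0 <= M) (L0 : 0 <= L) (a0 : 0 < a) (B0 : 0 <= B).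
Hypotheses (kappa0 : 0 <= kappa) (C0 : 0 <= C) (c10 : 0 <= c1) (m20 : 0 <= m2).

Definition bias_constant : R :=
  B * C + 2 * B * M * kappa ^+ 2 * (a + kappa) + 2 * B * c1 + B * c1 / 2
  + B * m2 / 2 + 2 * a * B * L * a `^ beta.

Definition variance_constant : R := B ^+ 2 * (2 * M * (a + kappa) + c1).

Variables (h delta r N : R).
Let y := h `^ beta.
Hypotheses (h0 : 0 < h) (h1 : h <= 1) (beta0 : 0 <= beta).
Hypotheses (N1 : 1 <= N) (Nr : N^-1 <= r) (ry : r <= y * h ^+ 2).
Hypothesis (deltar : delta ^+ 2 = kappa ^+ 2 * r).

Let i := N^-1.
Let i0 : 0 <= i. Proof. by rewrite /i invr_ge0 (le_trans ler01). Qed.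
Let i1 : i <= 1. Proof. by rewrite /i invf_le1// (lt_le_trans ltr01). Qed.
Let r0 : 0 <= r. Proof. exact: le_trans i0 Nr. Qed.
Let y0 : 0 <= y. Proof. exact: powR_ge0. Qed.
Let y1 : y <= 1.
Proof.
have := @ge0_ler_powR _ beta beta0 h 1; rewrite powR1; apply => //.
  by rewrite nnegrE ltW.
by rewrite nnegrE.
Qed.
Let ii : i ^+ 2 <= i. Proof. by rewrite expr2 ler_piMr. Qed.

Let rho := r / h.
Let rhoyh : rho <= y * h.
Proof. by rewrite /rho ler_pdivrMr//; apply: (le_trans ry); rewrite expr2 mulrA. Qed.
Let rrho : r <= rho.
Proof. by rewrite /rho ler_pdivlMr// ler_piMr. Qed.
Let ihrho : i / h <= rho.
Proof. by rewrite /rho ler_pM2r ?invr_gt0. Qed.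

(** Every term is a constant times i^2, i / h, r / h or h^(beta + 1), and the
    first three are at most r / h <= h^(beta + 1). *)
Lemma smoothing_bias_rate :
  0 <= smoothing_bias M beta L a B h delta kappa (c1 * i ^+ 2) (C * r) m2 N
    <= bias_constant * (y * h).
Proof.
have Nn0 : N != 0 by rewrite gt_eqF// (lt_le_trans ltr01).
have hn0 : h != 0 by rewrite gt_eqF.
have rho0 : 0 <= rho := le_trans r0 rrho.
have ih0 : 0 <= i / h by rewrite divr_ge0// ltW.
have ak0 : 0 <= a + kappa by rewrite addr_ge0// ltW.
have ab0 : 0 <= a `^ beta := powR_ge0 _ _.
have -> : smoothing_bias M beta L a B h delta kappa (c1 * i ^+ 2) (C * r) m2 N =
  B * C * rho + 2 * B * M * kappa ^+ 2 * (a + kappa) * rho + 2 * B * c1 * i ^+ 2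
  + B * c1 / 2 * (i / h) + B * m2 / 2 * (i / h) + 2 * a * B * L * a `^ beta * (y * h).
  rewrite /smoothing_bias powRM ?(ltW h0) ?(ltW a0)// -/y expr_div_n deltar.
  by rewrite /rho /i; field; rewrite Nn0 hn0.
have k1 : 0 <= B * C by rewrite mulr_ge0.
have k2 : 0 <= 2 * B * M * kappa ^+ 2 * (a + kappa).
  by rewrite mulr_ge0// mulr_ge0 ?sqr_ge0// !mulr_ge0.
have k3 : 0 <= 2 * B * c1 by rewrite !mulr_ge0.
have k4 : 0 <= B * c1 / 2 by rewrite divr_ge0// mulr_ge0.
have k5 : 0 <= B * m2 / 2 by rewrite divr_ge0// mulr_ge0.
have k6 : 0 <= 2 * a * B * L * a `^ beta.
  by rewrite mulr_ge0// mulr_ge0// mulr_ge0// mulr_ge0// ltW.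
have yh0 : 0 <= y * h by rewrite mulr_ge0// ltW.
have iyh : i ^+ 2 <= y * h by rewrite (le_trans ii)// (le_trans Nr)// (le_trans rrho).
have ihyh : i / h <= y * h := le_trans ihrho rhoyh.
apply/andP; split.
  by do !(apply: addr_ge0); apply: mulr_ge0 => //; exact: sqr_ge0.
have t1 := ler_wpM2l k1 rhoyh; have t2 := ler_wpM2l k2 rhoyh.
have t3 := ler_wpM2l k3 iyh; have t4 := ler_wpM2l k4 ihyh.
have t5 := ler_wpM2l k5 ihyh.
by rewrite /bias_constant; lra.
Qed.

Lemma risk_rate (m : nat) : (0 < m)%N -> m.+1%:R^-1 <= y ^+ 2 * h ->
  (B ^+ 2 * (M * (2 * ((a + kappa) * h)) + c1 * i ^+ 2) / m%:R
   + smoothing_bias M beta L a B h delta kappa (c1 * i ^+ 2) (C * r) m2 N ^+ 2) / h ^+ 2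
  <= (2 * variance_constant + bias_constant ^+ 2) * y ^+ 2.
Proof.
move=> m0 mh; have /andP[s0 sA] := smoothing_bias_rate.
set s := smoothing_bias _ _ _ _ _ _ _ _ _ _ _ _ in s0 sA *.
have ak0 : 0 <= a + kappa by rewrite addr_ge0// ltW.
have V0 : 0 <= variance_constant.
  by rewrite mulr_ge0 ?sqr_ge0// addr_ge0// !mulr_ge0.
have ih : i ^+ 2 <= h.
  apply: (le_trans ii); apply: (le_trans Nr); apply: (le_trans ry).
  by rewrite expr2 mulrA ler_piMl ?(ltW h0)// mulr_ile1// ltW.
have v1 : B ^+ 2 * (M * (2 * ((a + kappa) * h)) + c1 * i ^+ 2) <= variance_constant * h.
  rewrite /variance_constant -mulrA ler_wpM2l ?sqr_ge0//.
  rewrite [leRHS]mulrDl; apply: lerD; last by rewrite ler_wpM2l.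
  by rewrite le_eqVlt; apply/orP; left; apply/eqP; ring.
have mR : 0 < m%:R :> R by rewrite ltr0n.
have m2h : m%:R^-1 <= 2 * (y ^+ 2 * h).
  apply: (@le_trans _ _ (2 * m.+1%:R^-1)); last by rewrite ler_wpM2l.
  rewrite -[2]invrK -invfM lef_pV2 ?posrE ?mulr_gt0 ?invr_gt0//.
  rewrite mulrC ler_pdivrMr// -natrM ler_nat.
  by rewrite muln2 -addnn -addn1 leq_add2l.
have s2 : s ^+ 2 <= bias_constant ^+ 2 * (y * h) ^+ 2.
  by rewrite -exprMn lerXn2r// nnegrE (le_trans s0).
rewrite ler_pdivrMr ?exprn_gt0//.
have v2 : B ^+ 2 * (M * (2 * ((a + kappa) * h)) + c1 * i ^+ 2) / m%:R
   <= variance_constant * h * (2 * (y ^+ 2 * h)).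
  apply: (@le_trans _ _ (variance_constant * h / m%:R)).
    by rewrite ler_wpM2r ?invr_ge0.
  by rewrite ler_wpM2l// mulr_ge0// ltW.
apply: (le_trans (lerD v2 s2)).
by rewrite le_eqVlt; apply/orP; left; apply/eqP; ring.
Qed.

End risk_rate.

(** * The rates of convergence *)

Theorem theorem3p3 (R : realType) (beta : R) (beta_gt1 : 1 < beta) :
  exists h : nat -> nat -> R, (forall n m, 0 < h n m) /\
  forall (tau0 sigma L M : R) (F : set (R -> R)) (f : nat -> R -> R)
    (J : nat -> nat) (That : shift_estimators R) (K : R -> R)
    (d : measure_display) (Omega : measurableType d)
    (P : (R -> R) -> probability Omega R)
    (theta : nat -> nat -> {mfun Omega >-> R})
    (eps : nat -> nat -> nat -> {mfun Omega >-> R}),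
  0 < tau0 < 4^-1 -> 0 < sigma -> 0 < L -> 0 < M ->
  (forall g, F g -> measurable_fun [set: R] g) ->
  (forall j, F (f j)) ->
  (forall n, (1 <= J n)%N) ->
  (forall phi n, holder_density tau0 M beta L phi ->
     shift_model (P phi) phi n (J n) (theta n) (eps n)) ->
  approximates_shifts sigma tau0 J That F ->
  bias_control sigma tau0 J That f ->
  bounded_mse sigma tau0 J That f ->
  smooth K -> compactly_supported K -> kernel_of_order K (sfloor beta) ->
  J @ \oo --> \oo ->
  let risk n := maximal_risk P (Theta tau0) (holder_density tau0 M beta L)
    (fun w => density_estimator sigma J That f K n (h n (J n))
       (fun j => theta n j w) (fun i j => eps n i j w)) in
  ((\forall n \near \oo, (J n)%:R <= cutoff beta n) ->
     exists C : R, \forall n \near \oo,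
       (risk n <= (C * (J n)%:R `^ (- (2 * beta / (2 * beta + 1))))%:E)%E) /\
  ((\forall n \near \oo, cutoff beta n <= (J n)%:R) ->
     exists C : R, \forall n \near \oo,
       (risk n
        <= (C * (n%:R / ln n%:R) `^ (- (2 * beta / (beta + 2))))%:E)%E).
Proof.
exists (bandwidth beta); split; first exact: bandwidth_gt0.
move=> tau0 sigma L M F f J That K d Omega P theta eps _ _ L0 M0 mF Ff J1 model
  [mThat [c1 [c2 [c10 c20 dev]]]] [Cb bias] [Bm mse] sK csK Kord _ risk.
have [a [B KB]] := smooth_kernel_bounds sK csK.
have [a0 B0 _ _ _] := KB.
have cK : continuous K by apply: derivable_continuous => x; exact: (sK 0%N x).
(* With this K0, c2 * x_n ^+ 2 = 2 * ln n and the deviation bound is c1 / n ^ 2. *)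
pose kappa : R := Num.sqrt (2 / c2).
have kappa0 : 0 < kappa by rewrite sqrtr_gt0 divr_gt0.
(* Absolute values make the constants of the risk bound nonnegative. *)
pose C := `|Cb|; pose m2 := `|Bm|.
pose D := 2 * variance_constant M a B kappa c1
          + bias_constant M beta L a B kappa C c1 m2 ^+ 2.
have ln_large : \forall n \near \oo, 1 <= ln n%:R :> R.
  near=> n; rewrite -[leLHS](expRK 1) ler_ln ?posrE ?expR_gt0//.
    by near: n; exact: nbhs_infty_ger.
  by near: n; exact: nbhs_infty_gtr.
have risk_bound : \forall n \near \oo,
    (risk n <= (D * (bandwidth beta n (J n) `^ beta) ^+ 2)%:E)%E.
  have {}dev := dev kappa kappa0.
  apply: filterS (filterI (filterI dev bias) (filterI mse ln_large)).
  move=> n [[devn biasn] [msen ln1]].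
  have [h1 rh mh] := bandwidth_spec (J n) beta_gt1 ln1.
  have h0 := bandwidth_gt0 beta n (J n).
  set h := bandwidth beta n (J n) in h0 h1 rh mh *.
  have n1 : (1 <= n)%N.
    by rewrite lt0n; apply: contraTneq ln1 => ->; rewrite ln0// -ltNge ltr01.
  have n0 : 0 < n%:R :> R by rewrite ltr0n.
  have N1 : 1 <= n%:R :> R by rewrite ler1n.
  pose r : R := ln n%:R / n%:R.
  have nr : n%:R^-1 <= r by rewrite /r -[leLHS]mul1r ler_wpM2r ?invr_ge0// ltW.
  pose delta : R := kappa * Num.sqrt (ln n%:R) / Num.sqrt n%:R.
  have ln0 : 0 <= ln n%:R :> R by exact: le_trans ln1.
  have delta2 : delta ^+ 2 = kappa ^+ 2 * r.
    by rewrite /delta /r expr_div_n exprMn (sqr_sqrtr ln0) (sqr_sqrtr (ltW n0)) mulrA.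
  have b0 : 0 < beta by exact: lt_trans beta_gt1.
  have y1 : h `^ beta <= 1.
    have := @ge0_ler_powR _ beta (ltW b0) h 1; rewrite powR1; apply => //.
      by rewrite nnegrE ltW.
    by rewrite nnegrE.
  have dh : delta <= kappa * h.
    have d0 : 0 <= delta by rewrite divr_ge0 ?sqrtr_ge0// mulr_ge0 ?sqrtr_ge0// ltW.
    rewrite -(@ler_pXn2r _ 2) ?nnegrE ?(mulr_ge0 (ltW kappa0) (ltW h0))//.
    rewrite delta2 exprMn ler_wpM2l ?sqr_ge0//; apply: (le_trans rh).
    by rewrite ler_piMl ?sqr_ge0.
  have tail : c1 * expR (- (c2 * (kappa * Num.sqrt (ln n%:R)) ^+ 2)) = c1 * n%:R^-1 ^+ 2.
    congr (_ * _); rewrite exprMn !sqr_sqrtr ?divr_ge0 ?(ltW c20)//.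
    have -> : c2 * (2 / c2 * ln n%:R) = 2%:R * ln n%:R by field; rewrite gt_eqF.
    by rewrite expRN expRM_natl lnK ?posrE// exprVn.
  apply: ge_ereal_sup => _ [x xT <-]; apply: ge_ereal_sup => _ [phi phiH <-].
  have modeln := model phi n phiH; have [dens normal indep] := modeln.
  have gauss j : (j < J n)%N -> gaussian_noise (P phi) (fun i : 'I_n => eps n i j).
    by move=> jJ; apply: (gaussian_errors indep jJ) => i iN; exact: normal.
  have dev' j s : (j < J n)%N -> Theta tau0 s ->
      (P phi [set w | (delta < `|@That n j (curve sigma (f j) s (fun i : 'I_n => eps n i j w)) - s|)%R]
       <= (c1 * n%:R^-1 ^+ 2)%:E)%E.
    move=> jJ sT; have := devn j (f j) s jJ (Ff j) sT _ _ _ _ (gauss j jJ).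
    rewrite /= tail; apply: le_trans; rewrite le_eqVlt; apply/orP; left; apply/eqP.
    have deltaE (z : R) : (delta < z) = (kappa * Num.sqrt (ln n%:R) < Num.sqrt n%:R * z).
      by rewrite /delta ltr_pdivrMr ?sqrtr_gt0// [X in _ < X]mulrC.
    by congr (P phi _); apply/seteqP; split=> w /=; rewrite deltaE.
  have bias' j s : (j < J n)%N -> Theta tau0 s ->
      (`|'E_(P phi)[fun w => (@That n j (curve sigma (f j) s (fun i : 'I_n => eps n i j w)) - s)%R]|
       <= (C * r)%:E)%E.
    move=> jJ sT; apply: (le_trans (biasn j s jJ sT _ _ _ _ (gauss j jJ))).
    by rewrite lee_fin ler_wpM2r ?ler_norm// divr_ge0// ltW.
  have mse' j s : (j < J n)%N -> Theta tau0 s ->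
      ('E_(P phi)[fun w => ((@That n j (curve sigma (f j) s (fun i : 'I_n => eps n i j w)) - s) ^+ 2)%R]
       <= m2%:E)%E.
    move=> jJ sT; apply: (le_trans (msen j s jJ sT _ _ _ _ (gauss j jJ))).
    by rewrite lee_fin ler_norm.
  apply: (le_trans (density_estimator_risk beta_gt1 (ltW L0) phiH (J1 n) modeln KB cK
    Kord (mThat n) (fun j => mF _ (Ff j)) h0 (ltW kappa0) dh n0 dev' bias' mse' x)).
  rewrite lee_fin.
  exact: (risk_rate (ltW M0) (ltW L0) a0 B0 (ltW kappa0) (normr_ge0 _) (ltW c10)
    (normr_ge0 _) h0 h1 (ltW b0) N1 nr rh delta2 (J1 n) mh).
have D0 : 0 <= D.
  rewrite addr_ge0 ?sqr_ge0// mulr_ge0// mulr_ge0 ?sqr_ge0//.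
  by rewrite addr_ge0 ?(ltW c10)// mulr_ge0 ?mulr_ge0 ?addr_ge0// ltW.
split=> [few|many]; exists D; near=> n.
- have ln1 : 1 <= ln n%:R :> R by near: n.
  have rn : (risk n <= (D * (bandwidth beta n (J n) `^ beta) ^+ 2)%:E)%E by near: n.
  apply: (le_trans rn); rewrite lee_fin ler_wpM2l//.
  by apply: bandwidth_few_curves => //; near: n.
- have ln1 : 1 <= ln n%:R :> R by near: n.
  have rn : (risk n <= (D * (bandwidth beta n (J n) `^ beta) ^+ 2)%:E)%E by near: n.
  apply: (le_trans rn); rewrite lee_fin ler_wpM2l//.
  by apply: bandwidth_many_curves => //; near: n.
Unshelve. all: by end_near.
Qed.
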